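(* Let $z \in X\otimes_{\mathbb Z}\mathbb R$ lie in the interior $\overset{\circ}{C}$ of the Weyl chamber, and let $\chi=\chi_z$ be the unramified character with Satake parameter $z$. Let $\psi_\chi:B\to\mathbb C$ be a locally constant function such that: (1) $\mathbb E\left[(\chi^{-1}\psi_\chi)\left(b\,B_t(W^{(z)})\right)\right]=\chi(b)^{-1}\psi_\chi(b)$ for all $t\in\mathbb N$ and $b\in B$; (2) $\chi^{-1}\psi_\chi$ is bounded; (3) $(\chi^{-1}\psi_\chi)(\varpi^{-\lambda^\vee})\to b(z)e^{\langle z,\rho^\vee\rangle}$ as $\lambda^\vee\to\infty$ in the interior of the dual Weyl chamber ($\lambda^\vee \in X^\vee$ with $\langle\alpha,\lambda^\vee\rangle\to+\infty$ for all $\alpha\in\Delta$); (4) $\psi_\chi(nbk)=\varphi_N(n)\psi_\chi(b)$ for all $(n,b,k)\in N\times B\times B(\mathcal O)$. Then the following Poisson formula holds for all $\lambda^\vee\in X^\vee$: $$\psi_\chi(\varpi^{-\lambda^\vee})=b(z)\,e^{\langle z,\lambda^\vee+\rho^\vee\rangle}\,\mathbb E\left[\varphi_N\left(\varpi^{-\lambda^\vee}N_\infty(W^{(z)})\varpi^{\lambda^\vee}\right)\right].$$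
   Context: Field and group. $\mathcal K$ is a complete, locally compact field with discrete valuation $\mathrm{val}$, ring of integers $\mathcal O$, uniformizer $\varpi$ (with $\mathrm{val}(\varpi)=1$), residue field of cardinality $q$. $\mathbf G$ is a split reductive group scheme over $\mathbb Z$ (Chevalley), $\mathbf T$ a split maximal torus, $G=\mathbf G(\mathcal K)$, $T=\mathbf T(\mathcal K)$, $K=\mathbf G(\mathcal O)$. The root datum is $(X,\Phi,X^\vee,\Phi^\vee)$, with $X$ the characters and $X^\vee$ the cocharacters of $\mathbf T$ (written additively) and pairing $\langle\cdot,\cdot\rangle$ extended linearly. For $\mu^\vee\in X^\vee$, $\varpi^{\mu^\vee}\in T$ is the image of $\varpi$ under $\mu^\vee$. Positive roots $\Phi^+$ and simple roots $\Delta$ are fixed; $W$ is the Weyl group; $\rho^\vee$ is the half sum of positive coroots. $C=\{x\in X\otimes\mathbb R: \langle x,\alpha^\vee\rangle\ge0 \text{ for all simple coroots } \alpha^\vee\}$, with interior $\overset{\circ}{C}$; the dual Weyl chamber is $C^\vee=\{x\in X^\vee\otimes\mathbb R:\langle\alpha,x\rangle\ge0\ \forall\alpha\in\Delta\}$. A pinning $x_\beta:\mathbb G_a\to G$ ($\beta\in\Phi$) is fixed. $N$ is the lower unipotent subgroup generated by $x_{-\beta}(\mathcal K)$, $\beta\in\Phi^+$, and $B=NT$ is the lower Borel subgroup. $B(\mathcal O)=B\cap K$, $T(\mathcal O)=T\cap K$, $N(\mathcal O)=N\cap K$. Dual group. $G^\vee(\mathbb C)$ is the connected complex reductive group with root datum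 $(X^\vee,\Phi^\vee,X,\Phi)$; $V(\lambda^\vee)$ is its irreducible module of highest weight $\lambda^\vee$, and $\mathrm{ch}\,V(\lambda^\vee)(z)=\sum_{\mu^\vee}\dim V(\lambda^\vee)_{\mu^\vee}\,e^{\langle z,\mu^\vee\rangle}$. Minuscule hypothesis. For an irreducible root datum, a dominant coweight $\lambda^\vee$ is minuscule if it is non-zero and the weights of $V(\lambda^\vee)$ are exactly the Weyl orbit $W\lambda^\vee$, each with multiplicity one; in the reducible case a coweight is minuscule if it has a minuscule component in every irreducible factor. It is assumed that $G$ has a minuscule cocharacter $\Lambda^\vee\in X^\vee$, fixed once and for all. Characters. $\chi=\chi_z:T\to\mathbb C^*$ is the character trivial on $T(\mathcal O)$ with $\chi(\varpi^{-\mu^\vee})=e^{\langle z,\mu^\vee\rangle}$ for all $\mu^\vee\in X^\vee$, extended to $B$ trivially on $N$. $\psi:(\mathcal K,+)\to(\mathbb C^*,\times)$ is a (continuous, unitary) additive character trivial on $\mathcal O$ and non-trivial on $\varpi^{-1}\mathcal O$. $\varphi_N:N\to\mathbb C^*$ is $\varphi_N=\psi\circ\sum_{\alpha\in\Delta}\chi^-_\alpha$, where $\chi_\alpha^-:N\to\mathcal K$ is the additive character with $\chi^-_\alpha(x_{-\beta}(t))=t\,\mathbf 1_{\{\alpha=\beta\}}$ for $\beta\in\Phi^+$. Constant. $b(z)=\left(e^{\langle z,\rho^\vee\rangle}\prod_{\beta^\vee\in(\Phi^\vee)^+}(1-e^{-\langle z,\beta^\vee\rangle})\right)^{-1}$.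 Random walks. $W^{(z)}=(W^{(z)}_t;t\in\mathbb N)$ is the random walk on $X^\vee$ with $W_0^{(z)}=0$ and i.i.d. increments with law $\mathbb P(W^{(z)}_{t+1}-W^{(z)}_t=\mu^\vee)=e^{\langle z,\mu^\vee\rangle}/\mathrm{ch}\,V(\Lambda^\vee)(z)$ for $\mu^\vee\in W\Lambda^\vee$. The random walk $(B_t(W^{(z)}))_{t\in\mathbb N}$ on $B$ is defined by $B_0(W^{(z)})=b_0$ and $B_{t+1}(W^{(z)})=B_t(W^{(z)})\,b'_{t+1}\,\varpi^{-(W^{(z)}_{t+1}-W^{(z)}_t)}\,b_{t+1}$, where the $b_t$, $b'_t$ are all independent, independent of $W^{(z)}$, and Haar distributed on $B(\mathcal O)$. Its $N$-part $N_t(W^{(z)})\in N$ is defined by $B_t(W^{(z)})\in N_t(W^{(z)})\,\varpi^{-W^{(z)}_t}\,T(\mathcal O)$; it satisfies $N_0(W^{(z)})=n_0$ and $N_{t+1}(W^{(z)})=N_t(W^{(z)})\,\varpi^{-W_t^{(z)}}n'_{t+1}\varpi^{W_t^{(z)}}\,\varpi^{-W_{t+1}^{(z)}}n_{t+1}\varpi^{W_{t+1}^{(z)}}$, with $n_t,n'_t$ all independent, independent of $W^{(z)}$, Haar distributed on $N(\mathcal O)$. The sequence $N_t(W^{(z)})$ converges almost surely as $t\to\infty$ in the topology of $N$; $N_\infty(W^{(z)})$ denotes its limit. *)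

(* Defs.v *)
From HB Require Import structures.
From mathcomp Require Import all_boot all_order all_algebra.
From mathcomp Require Import complex.
From mathcomp Require Import all_classical all_reals all_analysis.

Set Implicit Arguments.
Unset Strict Implicit.
Unset Printing Implicit Defensive.

Import Order.TTheory GRing.Theory Num.Theory.
Import numFieldNormedType.Exports.

Local Open Scope classical_set_scope.
Local Open Scope ring_scope.

(* [valuation 0] is a junk value: the valuation of 0 is +oo, and [vge x m] is the
   statement val(x) >= m with that convention. *)
Definition vge_of (K : fieldType) (v : K -> int) (x : K) (m : int) : bool :=
  (x == 0) || (m <= v x).

HB.mixin Record Field_isLocal K of GRing.Field K & Topological K := {
  valuation : K -> int;
  valM : forall x y : K, x != 0 -> y != 0 ->
    valuation (x * y) = valuation x + valuation y;
  valD : forall (x y : K) (m : int),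
    vge_of valuation x m -> vge_of valuation y m -> vge_of valuation (x + y) m;
  val_surj : forall m : int, exists2 x : K, x != 0 & valuation x = m;
  nbhs_val : forall (x : K) (A : set K),
    nbhs x A <-> exists m : int, [set y | vge_of valuation (y - x) m] `<=` A;
  val_complete : forall u : nat -> K,
    (forall m : int, exists N : nat, forall i j : nat,
      (N <= i)%N -> (N <= j)%N -> vge_of valuation (u i - u j) m) ->
    exists l : K, u @ \oo --> l;
  val_locally_compact : locally_compact [set: K]
}.

#[short(type="localFieldType")]
HB.structure Definition LocalField :=
  {K of GRing.Field K & Topological K & Field_isLocal K}.

Definition vge (K : localFieldType) (x : K) (m : int) : bool := vge_of valuation x m.

(* X and X^vee are both Z^n, in dual bases. *)
Definition ipair n (x y : 'rV[int]_n) : int := \sum_(k < n) x 0 k * y 0 k.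

(* Roots and coroots are indexed by the same finite type, the bijection
   beta |-> beta^vee being the identity on indices. *)
Record root_datum (n : nat) := RootDatum {
  rd_index : finType;
  root_of : rd_index -> 'rV[int]_n;
  coroot_of : rd_index -> 'rV[int]_n;
  root_inj : injective root_of;
  coroot_inj : injective coroot_of;
  root_coroot2 : forall i, ipair (root_of i) (coroot_of i) = 2;
  root_refl : forall i j, exists k, root_of k =
    root_of j - root_of i *~ ipair (root_of j) (coroot_of i);
  coroot_refl : forall i j, exists k, coroot_of k =
    coroot_of j - coroot_of i *~ ipair (root_of i) (coroot_of j);
  root_reduced : forall i j, root_of i <> root_of j *+ 2;
  coroot_reduced : forall i j, coroot_of i <> coroot_of j *+ 2
}.

Lemma ipairC n (x y : 'rV[int]_n) : ipair x y = ipair y x.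
Proof. by apply: eq_bigr => k _; rewrite mulrC. Qed.

Lemma ipairDl n (x y z : 'rV[int]_n) : ipair (x + y) z = ipair x z + ipair y z.
Proof. by rewrite -big_split /=; apply: eq_bigr => k _; rewrite mxE mulrDl. Qed.

Lemma ipair0l n (z : 'rV[int]_n) : ipair 0 z = 0.
Proof. by apply: big1 => k _; rewrite mxE mul0r. Qed.

Definition dual_datum n (D : root_datum n) : root_datum n.
Proof.
refine (@RootDatum n (rd_index D) (@coroot_of n D) (@root_of n D)
  (@coroot_inj n D) (@root_inj n D) _ _ _
  (@coroot_reduced n D) (@root_reduced n D)).
- by move=> i; rewrite ipairC root_coroot2.
- by move=> i j; have [k ek] := coroot_refl i j; exists k; rewrite ek ipairC.
- by move=> i j; have [k ek] := root_refl i j; exists k; rewrite ek ipairC.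
Defined.

Section PositiveRoots.
Variables (n : nat) (D : root_datum n) (Delta : {set rd_index D}).

Definition positive (i : rd_index D) : Prop :=
  exists c : rd_index D -> nat, root_of i = \sum_(j in Delta) root_of j *+ c j.

Definition negative (i : rd_index D) : Prop :=
  exists2 j, positive j & root_of i = - root_of j.

Definition is_base : Prop :=
  (forall c : rd_index D -> int,
     \sum_(j in Delta) root_of j *~ c j = 0 -> forall j, j \in Delta -> c j = 0)
  /\ (forall i, positive i \/ negative i).

Definition dominant (lam : 'rV[int]_n) : Prop :=
  forall j, j \in Delta -> 0 <= ipair (root_of j) lam.

End PositiveRoots.

Inductive weyl_orbit n (D : root_datum n) (lam : 'rV[int]_n) :
    'rV[int]_n -> Prop :=
| weyl_orbit_refl : weyl_orbit D lam lam
| weyl_orbit_step mu (i : rd_index D) : weyl_orbit D lam mu ->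
    weyl_orbit D lam (mu - coroot_of i *~ ipair (root_of i) mu).

Section RealVectors.
Variables (R : realType) (n : nat) (D : root_datum n) (Delta : {set rd_index D}).

Definition rpair (z w : 'rV[R]_n) : R := \sum_(k < n) z 0 k * w 0 k.

Definition real_vect (mu : 'rV[int]_n) : 'rV[R]_n :=
  \row_k (mu 0 k)%:~R.

Definition weyl_chamber : set 'rV[R]_n :=
  [set x | forall j, j \in Delta -> 0 <= rpair x (real_vect (coroot_of j))].

Definition rho_vee : 'rV[R]_n :=
  2^-1 *: \sum_(i : rd_index D | `[< positive Delta i >]) real_vect (coroot_of i).

Definition bconst (z : 'rV[R]_n) : R :=
  (expR (rpair z rho_vee) *
   \prod_(i : rd_index D | `[< positive Delta i >])
     (1 - expR (- rpair z (real_vect (coroot_of i)))))^-1.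

End RealVectors.

Arguments rho_vee R {n D} Delta.
Arguments weyl_chamber R {n D} Delta.
Arguments bconst {R n D} Delta z.

(* An affine group scheme over Z is its coordinate ring Z[G] together with a
   group law, natural in R, on the R-points Hom(Z[G], R). *)
Record affine_group := AffineGroup {
  ag_coord : comNzRingType;
  ag_mul : forall R : comNzRingType, {rmorphism ag_coord -> R} ->
    {rmorphism ag_coord -> R} -> {rmorphism ag_coord -> R};
  ag_one : forall R : comNzRingType, {rmorphism ag_coord -> R};
  ag_inv : forall R : comNzRingType,
    {rmorphism ag_coord -> R} -> {rmorphism ag_coord -> R};
  ag_mulA : forall R, associative (@ag_mul R);
  ag_1mul : forall R, left_id (@ag_one R) (@ag_mul R);
  ag_mul1 : forall R, right_id (@ag_one R) (@ag_mul R);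
  ag_Vmul : forall R, left_inverse (@ag_one R) (@ag_inv R) (@ag_mul R);
  ag_mulV : forall R, right_inverse (@ag_one R) (@ag_inv R) (@ag_mul R);
  ag_natural : forall (R S : comNzRingType) (f : {rmorphism R -> S})
    (g h : {rmorphism ag_coord -> R}),
    ag_mul (f \o g) (f \o h) = (f \o ag_mul g h) :> {rmorphism ag_coord -> S}
}.

Definition gpts (G : affine_group) (R : comNzRingType) : Type :=
  {rmorphism ag_coord G -> R}.

HB.instance Definition _ (G : affine_group) (R : comNzRingType) :=
  gen_eqMixin (gpts G R).
HB.instance Definition _ (G : affine_group) (R : comNzRingType) :=
  gen_choiceMixin (gpts G R).
HB.instance Definition _ (G : affine_group) (R : comNzRingType) :=
  isGroup.Build (gpts G R) (@ag_mulA G R) (@ag_1mul G R) (@ag_mul1 G R)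
    (@ag_Vmul G R) (@ag_mulV G R).

Definition ag_eval (G : affine_group) (R : comNzRingType) (g : gpts G R) :
  ag_coord G -> R := (g : {rmorphism ag_coord G -> R}).

Definition gmap (G : affine_group) (R S : comNzRingType) (f : {rmorphism R -> S})
    (g : gpts G R) : gpts G S :=
  (f \o (g : {rmorphism ag_coord G -> R}) : {rmorphism ag_coord G -> S}).

Definition finite_type (G : affine_group) : Prop :=
  exists s : seq (ag_coord G), forall S : {pred ag_coord G},
    subring_closed S -> {subset s <= S} -> forall a, a \in S.

(* Infinitesimal lifting criterion; for schemes of finite type over Z it is
   equivalent to smoothness. *)
Definition smooth (G : affine_group) : Prop :=
  forall (R S : comNzRingType) (f : {rmorphism R -> S}),
    (forall y, exists x, f x = y) ->
    (forall x y, f x = 0 -> f y = 0 -> x * y = 0) ->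
    forall g : gpts G S, exists h : gpts G R, gmap f h = g.

(* Fibres over algebraically closed fields k, through the Zariski topology on
   G(k). *)
Section GeometricFibre.
Variables (G : affine_group) (k : closedFieldType).
Implicit Types (H Z : set (gpts G k)).

(* The functions on G(k) coming from k (x) Z[G]. *)
Definition regular_fun (f : gpts G k -> k) : Prop :=
  exists s : seq (k * ag_coord G), forall g, f g = \sum_(p <- s) p.1 * ag_eval g p.2.

Definition zclosed Z : Prop :=
  exists2 E : set (gpts G k -> k), (forall f, E f -> regular_fun f) &
    Z = [set g | forall f, E f -> f g = 0].

Definition zconnected Z : Prop :=
  Z !=set0 /\ forall Z1 Z2, zclosed Z1 -> zclosed Z2 ->
    Z `<=` Z1 `|` Z2 -> Z `&` Z1 `&` Z2 = set0 -> Z `<=` Z1 \/ Z `<=` Z2.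

Definition is_subgroup H : Prop :=
  [/\ H 1%g, forall g h, H g -> H h -> H (g * h)%g & forall g, H g -> H g^-1%g].

Definition is_normal H : Prop := forall g h, H h -> H (g * h * g^-1)%g.

(* Right translation by u is locally unipotent on the coordinate ring k[G]. *)
Definition unipotent_elt (u : gpts G k) : Prop :=
  forall f, regular_fun f -> exists m : nat,
    iter m (fun (h : gpts G k -> k) g => h (g * u)%g - h g) f = (fun=> 0).

Definition reductive_fibre : Prop :=
  zconnected setT /\
  forall H, is_subgroup H -> is_normal H -> zclosed H -> zconnected H ->
    (forall h, H h -> unipotent_elt h) -> H = [set 1%g].

End GeometricFibre.

Record gm_pt (R : comNzRingType) := GmPt {
  gm_val : R; gm_inv : R; gm_valV : gm_val * gm_inv = 1 }.

Definition gm_pow (R : comNzRingType) (u : gm_pt R) (m : int) : R :=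
  match m with Posz j => gm_val u ^+ j | Negz j => gm_inv u ^+ j.+1 end.

Lemma gm_pow0 R (u : gm_pt R) : gm_pow u 0 = 1. Proof. by []. Qed.

Lemma gm_powS R (u : gm_pt R) m : gm_pow u (m + 1) = gm_pow u m * gm_val u.
Proof.
case: m => [m|[|m]].
- by rewrite -PoszD addn1 /= exprSr.
- by rewrite NegzE addNr /= expr1 mulrC gm_valV.
- have -> : Negz m.+1 + 1 = Negz m.
    by rewrite !NegzE -[m.+2]addn1 PoszD opprD addrNK.
  by rewrite /= [_ ^+ m.+2]exprSr -mulrA [gm_inv u * _]mulrC gm_valV mulr1.
Qed.

Lemma gm_powD R (u : gm_pt R) m l : gm_pow u (m + l) = gm_pow u m * gm_pow u l.
Proof.
elim/int_rect: l => [|l IH|l IH]; first by rewrite addr0 gm_pow0 mulr1.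
- by rewrite -addn1 PoszD addrA !gm_powS IH mulrA.
- have e : - l%:Z = - l.+1%:Z + 1 by rewrite -addn1 PoszD opprD addrNK.
  have := gm_powS u (m - l.+1%:Z); rewrite -addrA -e IH {1}e gm_powS => h.
  have := congr1 (fun x => x * gm_inv u) h.
  by rewrite -!mulrA gm_valV !mulr1 => <-.
Qed.

Definition gm_of (k : fieldType) (x : k) (x0 : x != 0) : gm_pt k :=
  GmPt (mulfV x0).

(* R-points of the split torus with character lattice Z^n: multiplicative
   functions on characters, i.e. Hom(Z^n, R^* ). *)
Record torus_pt (n : nat) (R : comNzRingType) := TorusPt {
  tval :> 'rV[int]_n -> R;
  tval0 : tval 0 = 1;
  tvalD : forall x y, tval (x + y) = tval x * tval y
}.

Definition torus_mul n R (s t : torus_pt n R) : torus_pt n R.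
Proof.
refine (@TorusPt n R (fun x => s x * t x) _ _).
- by rewrite !tval0 mulr1.
- by move=> x y; rewrite !tvalD mulrACA.
Defined.

Definition torus_map n (R S : comNzRingType) (f : {rmorphism R -> S})
  (t : torus_pt n R) : torus_pt n S.
Proof.
refine (@TorusPt n S (fun x => f (t x)) _ _).
- by rewrite tval0 rmorph1.
- by move=> x y; rewrite tvalD rmorphM.
Defined.

Definition cochar n (R : comNzRingType) (mu : 'rV[int]_n) (u : gm_pt R) :
  torus_pt n R.
Proof.
refine (@TorusPt n R (fun x => gm_pow u (ipair x mu)) _ _).
- by rewrite ipair0l.
- by move=> x y; rewrite ipairDl gm_powD.
Defined.

(* k[eps], a + b eps being the pair (a, b); not the product ring k * k. *)
Definition dualnum (k : comNzRingType) : Type := (k * k)%type.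

Section DualNumbers.
Variable k : comNzRingType.

HB.instance Definition _ := GRing.Zmodule.on (dualnum k).

Definition dn_mul (x y : dualnum k) : dualnum k :=
  (x.1 * y.1, x.1 * y.2 + x.2 * y.1).
Definition dn_one : dualnum k := (1, 0).

Fact dn_mulA : associative dn_mul.
Proof.
move=> x y z; rewrite /dn_mul /= mulrA mulrDr mulrDl !mulrA addrA.
by congr (_, _).
Qed.
Fact dn_mulC : commutative dn_mul.
Proof.
by move=> x y; rewrite /dn_mul mulrC addrC [x.2 * _]mulrC [x.1 * y.2]mulrC.
Qed.
Fact dn_mul1 : left_id dn_one dn_mul.
Proof. by case=> a b; rewrite /dn_mul /= !mul1r mul0r addr0. Qed.
Fact dn_mulDl : left_distributive dn_mul +%R.
Proof. by move=> x y z; rewrite /dn_mul /= !mulrDl; congr (_, _); rewrite addrACA. Qed.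
Fact dn_1neq0 : dn_one != 0.
Proof. by apply/eqP => -[/eqP]; rewrite oner_eq0. Qed.

HB.instance Definition _ := GRing.Zmodule_isComNzRing.Build (dualnum k)
  dn_mulA dn_mulC dn_mul1 dn_mulDl dn_1neq0.

Definition dn_const (a : k) : dualnum k := (a, 0).
Definition dn_red (x : dualnum k) : k := x.1.
Definition dn_scale (c : k) (x : dualnum k) : dualnum k := (x.1, c * x.2).

Fact dn_const_additive : zmod_morphism dn_const.
Proof. by move=> a b; congr (_, _); rewrite subr0. Qed.
Fact dn_const_multiplicative : monoid_morphism dn_const.
Proof. by split=> // a b; congr (_, _); rewrite mulr0 mul0r addr0. Qed.
HB.instance Definition _ :=
  GRing.isZmodMorphism.Build k (dualnum k) dn_const dn_const_additive.
HB.instance Definition _ :=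
  GRing.isMonoidMorphism.Build k (dualnum k) dn_const dn_const_multiplicative.

Fact dn_red_additive : zmod_morphism dn_red. Proof. by []. Qed.
Fact dn_red_multiplicative : monoid_morphism dn_red. Proof. by []. Qed.
HB.instance Definition _ :=
  GRing.isZmodMorphism.Build (dualnum k) k dn_red dn_red_additive.
HB.instance Definition _ :=
  GRing.isMonoidMorphism.Build (dualnum k) k dn_red dn_red_multiplicative.

Fact dn_scale_additive c : zmod_morphism (dn_scale c).
Proof. by move=> x y; congr (_, _); rewrite mulrBr. Qed.
Fact dn_scale_multiplicative c : monoid_morphism (dn_scale c).
Proof.
split=> [|x y]; first by congr (_, _); rewrite mulr0.
by congr (_, _); rewrite /= mulrDr !mulrA [c * x.1]mulrC.
Qed.
HB.instance Definition _ c :=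
  GRing.isZmodMorphism.Build (dualnum k) (dualnum k) (dn_scale c)
    (dn_scale_additive c).
HB.instance Definition _ c :=
  GRing.isMonoidMorphism.Build (dualnum k) (dualnum k) (dn_scale c)
    (dn_scale_multiplicative c).

End DualNumbers.

Section TorusInGroup.
Variables (G : affine_group) (n : nat)
  (tau : forall R : comNzRingType, torus_pt n R -> gpts G R).

(* The last clause says that Z[G] -> Z[X] is onto: tau is a closed immersion. *)
Definition is_subtorus : Prop :=
  [/\ forall (R S : comNzRingType) (f : {rmorphism R -> S}) t,
        tau (torus_map f t) = gmap f (tau t),
      forall (R : comNzRingType) (s t : torus_pt n R),
        tau (torus_mul s t) = (tau s * tau t)%g &
      forall x : 'rV[int]_n, exists a : ag_coord G,
        forall (R : comNzRingType) (t : torus_pt n R), ag_eval (tau t) a = t x].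

(* Tori of G_k are the images of algebraic homomorphisms from split tori. *)
Definition is_maximal_torus (k : closedFieldType) : Prop :=
  forall (m : nat) (sigma : torus_pt m k -> gpts G k),
    (forall s t, sigma (torus_mul s t) = (sigma s * sigma t)%g) ->
    (forall a : ag_coord G, exists c : seq (k * 'rV[int]_m),
       forall t, ag_eval (sigma t) a = \sum_(p <- c) p.1 * t p.2) ->
    range (@tau k) `<=` range sigma -> range sigma = range (@tau k).

(* gamma is a weight of the adjoint action of T on
   Lie(G_k) = ker (G(k[eps]) -> G(k)), on which k acts by eps |-> c eps. *)
Definition adjoint_weight (k : closedFieldType) (gamma : 'rV[int]_n) : Prop :=
  exists v : gpts G (dualnum k),
    [/\ gmap (@dn_red k) v = 1%g, v <> 1%g &
        forall t : torus_pt n k,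
          (gmap (@dn_const k) (tau t) * v * (gmap (@dn_const k) (tau t))^-1)%g
          = gmap (dn_scale (t gamma)) v].

End TorusInGroup.

Record split_reductive (n : nat) (D : root_datum n) := SplitReductive {
  sr_group :> affine_group;
  sr_finite_type : finite_type sr_group;
  sr_smooth : smooth sr_group;
  sr_reductive : forall k : closedFieldType, reductive_fibre sr_group k;

  sr_torus : forall R : comNzRingType, torus_pt n R -> gpts sr_group R;
  sr_torusP : is_subtorus sr_torus;
  sr_torus_max : forall k : closedFieldType, is_maximal_torus sr_torus k;
  sr_roots : forall (k : closedFieldType) (gamma : 'rV[int]_n), gamma != 0 ->
    adjoint_weight sr_torus k gamma <-> exists i : rd_index D, root_of i = gamma;

  sr_x : forall (i : rd_index D) (R : comNzRingType), R -> gpts sr_group R;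
  sr_x_natural : forall i (R S : comNzRingType) (f : {rmorphism R -> S}) (s : R),
    sr_x i (f s) = gmap f (sr_x i s);
  sr_xD : forall i (R : comNzRingType) (s t : R),
    sr_x i (s + t) = (sr_x i s * sr_x i t)%g;
  sr_x_immersion : forall i, exists a : ag_coord sr_group,
    forall (R : comNzRingType) (s : R), ag_eval (sr_x i s) a = s;
  sr_x_torus : forall i (R : comNzRingType) (t : torus_pt n R) (s : R),
    (sr_torus t * sr_x i s * (sr_torus t)^-1)%g = sr_x i (t (root_of i) * s);

  (* The SL_2-relation that determines the coroot beta^vee; x_{-beta} is
     only assumed to match x_beta up to a sign. *)
  sr_coroot : forall i j, root_of j = - root_of i ->
    exists2 c : int, c = 1 \/ c = -1 &
    forall (R : comNzRingType) (a b : R) (u : gm_pt R),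
      gm_val u = 1 + a * b ->
      (sr_x i a * sr_x j (b *~ c))%g =
      (sr_x j ((b * gm_inv u) *~ c) * sr_torus (cochar (coroot_of i) u)
       * sr_x i (a * gm_inv u))%g
}.

(* Topology of pointwise convergence on Z[G]. *)
HB.instance Definition _ (G : affine_group) (K : localFieldType) :=
  Topological.copy (gpts G K)
    (initial_topology (@ag_eval G K : gpts G K -> {ptws ag_coord G -> K})).
HB.instance Definition _ (G : affine_group) (K : localFieldType) :=
  isPointed.Build (gpts G K) 1%g.

Definition borel_gpts (G : affine_group) (K : localFieldType) :=
  g_sigma_algebraType (@open (gpts G K)).

Record rational_rep (G : affine_group) (k : closedFieldType) := RationalRep {
  rep_dim : nat;
  rep_mx :> gpts G k -> 'M[k]_rep_dim;
  rep_mx1 : rep_mx 1%g = 1%:M;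
  rep_mxM : forall g h, rep_mx (g * h)%g = rep_mx g *m rep_mx h;
  rep_regular : forall i j, regular_fun (fun g => rep_mx g i j)
}.

Section HighestWeight.
Variables (n : nat) (E : root_datum n) (Delta : {set rd_index E}).
Variables (H : split_reductive E) (k : closedFieldType) (V : rational_rep H k).

Definition irreducible_rep : Prop :=
  (0 < rep_dim V)%N /\
  forall U : {vspace 'cV[k]_(rep_dim V)},
    (forall g v, v \in U -> V g *m v \in U) -> U = 0%VS \/ U = fullv.

Definition weight_vector (mu : 'rV[int]_n) (v : 'cV[k]_(rep_dim V)) : Prop :=
  forall t : torus_pt n k, V (sr_torus H t) *m v = t mu *: v.

(* The set of vectors of weight mu is a subspace, which [xget] picks. *)
Definition weight_space (mu : 'rV[int]_n) : {vspace 'cV[k]_(rep_dim V)} :=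
  xget 0%VS [set U : {vspace 'cV[k]_(rep_dim V)} |
    forall v, v \in U <-> weight_vector mu v].

Definition weight_mult (mu : 'rV[int]_n) : nat := \dim (weight_space mu).

Definition has_highest_weight (lam : 'rV[int]_n) : Prop :=
  exists v, [/\ v != 0, weight_vector lam v &
    forall i, positive Delta i -> forall s : k, V (sr_x H i s) *m v = v].

Definition is_highest_weight_module (lam : 'rV[int]_n) : Prop :=
  irreducible_rep /\ has_highest_weight lam.

End HighestWeight.

Definition rep_char (R : realType) n (E : root_datum n) (H : split_reductive E)
    (V : rational_rep H R[i]) (z : 'rV[R]_n) : R :=
  \sum_(mu \in [set: 'rV[int]_n])
    (weight_mult V mu)%:R * expR (rpair z (real_vect R mu)).

Section Minuscule.
Variable R : realType.

Definition minuscule_irreducible n (D : root_datum n) (Delta : {set rd_index D})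
    (lam : 'rV[int]_n) : Prop :=
  [/\ dominant Delta lam, lam != 0 &
    exists (Gv : split_reductive (dual_datum D)) (V : rational_rep Gv R[i]),
      is_highest_weight_module (Delta : {set rd_index (dual_datum D)}) V lam /\
      forall mu, (weyl_orbit D lam mu -> weight_mult V mu = 1%N) /\
                 (~ weyl_orbit D lam mu -> weight_mult V mu = 0%N)].

(* The irreducible components of Phi are the classes of [connect root_adj]. *)
Definition root_adj n (D : root_datum n) (i j : rd_index D) : bool :=
  (ipair (root_of i) (coroot_of j) != 0) ||
  (ipair (root_of j) (coroot_of i) != 0).

(* D' is the irreducible factor of D with set of roots J: its character lattice
   is the root lattice Z J, embedded in X by x |-> x *m F, so that the component
   in Hom(Z J, Z) of a coweight lam of D is lam *m F^T. *)
Definition irreducible_factor n (D : root_datum n) (J : {set rd_index D})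
    m (D' : root_datum m) (e : rd_index D' -> rd_index D)
    (F : 'M[int]_(m, n)) : Prop :=
  [/\ injective e,
      forall j, j \in J <-> exists i, e i = j,
      forall i, root_of (e i) = root_of i *m F,
      forall i, coroot_of i = coroot_of (e i) *m F^T &
      forall x : 'rV[int]_m, exists c : rd_index D' -> int,
        x = \sum_i root_of i *~ c i].

Definition minuscule n (D : root_datum n) (Delta : {set rd_index D})
    (lam : 'rV[int]_n) : Prop :=
  forall i : rd_index D,
    exists m (D' : root_datum m) (e : rd_index D' -> rd_index D)
      (F : 'M[int]_(m, n)),
      irreducible_factor [set j | connect (@root_adj n D) i j]%SET e F /\
      minuscule_irreducible (e @^-1: Delta) (lam *m F^T).

End Minuscule.

Section LocalGroup.
Variables (n : nat) (D : root_datum n) (Delta : {set rd_index D}).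
Variables (G : split_reductive D) (K : localFieldType).

Definition torus_elt (x : K) (x0 : x != 0) (mu : 'rV[int]_n) : gpts G K :=
  sr_torus G (cochar mu (gm_of x0)).

Definition Tgrp : set (gpts G K) := range (@sr_torus n D G K).

Definition Kgrp : set (gpts G K) := [set g | forall a, vge (ag_eval g a) 0].

Inductive Ngrp : gpts G K -> Prop :=
| Ngrp1 : Ngrp 1%g
| Ngrp_gen i (s : K) : negative Delta i -> Ngrp (sr_x G i s)
| NgrpM g h : Ngrp g -> Ngrp h -> Ngrp (g * h)%g
| NgrpV g : Ngrp g -> Ngrp g^-1%g.

Definition Bgrp : set (gpts G K) :=
  [set b | exists g t, [/\ Ngrp g, Tgrp t & b = (g * t)%g]].

Definition TO : set (gpts G K) := Tgrp `&` Kgrp.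
Definition BO : set (gpts G K) := Bgrp `&` Kgrp.

End LocalGroup.

Arguments torus_elt {n D} G {K x} x0 mu.
Arguments Tgrp {n D} G K.
Arguments Kgrp {n D} G K.
Arguments Ngrp {n D} Delta G K.
Arguments Bgrp {n D} Delta G K.
Arguments TO {n D} G K.
Arguments BO {n D} Delta G K.

Definition locally_constant_on (X : topologicalType) (Y : Type) (A : set X)
    (f : X -> Y) : Prop :=
  forall x, A x -> \forall y \near within A (nbhs x), f y = f x.

Section Characters.
Variables (R : realType) (n : nat) (D : root_datum n) (Delta : {set rd_index D}).
Variables (G : split_reductive D) (K : localFieldType).
Variables (varpi : K) (varpi0 : varpi != 0).

Definition unramified_character (z : 'rV[R]_n) (chi : gpts G K -> R[i]) : Prop :=
  [/\ forall b c, Bgrp Delta G K b -> Bgrp Delta G K c ->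
        chi (b * c)%g = chi b * chi c,
      forall g, Ngrp Delta G K g -> chi g = 1,
      forall t, TO G K t -> chi t = 1 &
      forall mu, chi (torus_elt G varpi0 (- mu)) =
        (expR (rpair z (real_vect R mu)))%:C%C].

Definition additive_character (psi : K -> R[i]) : Prop :=
  [/\ forall x y, psi (x + y) = psi x * psi y,
      forall x, `|psi x| = 1,
      continuous (psi : K -> R[i]^o),
      forall x, vge x 0 -> psi x = 1 &
      exists2 x, vge x (-1) & psi x <> 1].

Definition simple_additive_character (a : rd_index D) (f : gpts G K -> K) : Prop :=
  (forall g h, Ngrp Delta G K g -> Ngrp Delta G K h -> f (g * h)%g = f g + f h) /\
  (forall i s, negative Delta i ->
     f (sr_x G i s) = if root_of i == - root_of a then s else 0).

End Characters.

Section Probability.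
Context {d : measure_display} {T : measurableType d} {R : realType}.
Variable P : probability T R.

Definition cexpect (f : T -> R[i]) : R[i] :=
  ((\int[P]_w complex.Re (f w)) +i* (\int[P]_w complex.Im (f w)))%C.

Definition independent_family (I : eqType) (F : I -> set (set T)) : Prop :=
  forall (s : seq I) (A : I -> set T), uniq s ->
    (forall i, i \in s -> F i (A i)) ->
    P (\bigcap_(i in [set` s]) A i) = (\prod_(i <- s) P (A i))%E.

Section Haar.
Variables (G : affine_group) (K : localFieldType).

Definition sigma_of_gpts (X : T -> gpts G K) : set (set T) :=
  [set X @^-1` A | A in (measurable : set (set (borel_gpts G K)))].

(* X is distributed according to the Haar probability of the compact group S. *)
Definition haar_distributed (S : set (gpts G K)) (X : T -> gpts G K) : Prop :=
  [/\ measurable_fun setT (X : T -> borel_gpts G K),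
      forall w, S (X w) &
      forall h (A : set (borel_gpts G K)), S h -> measurable A ->
        P [set w | A (h * X w)%g] = P [set w | A (X w)]].

End Haar.

Section RandomWalk.
Variables (n : nat) (D : root_datum n).

Definition walk_incr (W : nat -> T -> 'rV[int]_n) (t : nat) (w : T) :
  'rV[int]_n := W t.+1 w - W t w.

Definition weight_walk (Lam : 'rV[int]_n) (z : 'rV[R]_n) (ch : R)
    (W : nat -> T -> 'rV[int]_n) : Prop :=
  [/\ forall t mu, measurable [set w | W t w = mu],
      forall w, W 0%N w = 0,
      independent_family (fun t => [set walk_incr W t @^-1` A | A in setT]) &
      forall t mu,
        (weyl_orbit D Lam mu -> P [set w | walk_incr W t w = mu] =
           (expR (rpair z (real_vect R mu)) / ch)%:E) /\
        (~ weyl_orbit D Lam mu -> P [set w | walk_incr W t w = mu] = 0%E)].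

Variables (Delta : {set rd_index D}) (G : split_reductive D) (K : localFieldType).
Variables (varpi : K) (varpi0 : varpi != 0).

Definition sigma_of_walk (W : nat -> T -> 'rV[int]_n) : set (set T) :=
  <<s [set A | exists t S, A = W t @^-1` S] >>.

(* The value b' 0 is not used. *)
Definition group_walk (W : nat -> T -> 'rV[int]_n) (b b' : nat -> T -> gpts G K)
    (B : nat -> T -> gpts G K) : Prop :=
  [/\ forall t, haar_distributed (BO Delta G K) (b t),
      forall t, haar_distributed (BO Delta G K) (b' t.+1),
      independent_family (fun i : option (nat + nat) =>
        match i with
        | None => sigma_of_walk W
        | Some (inl t) => sigma_of_gpts (b t)
        | Some (inr t) => sigma_of_gpts (b' t.+1)
        end),
      forall t, measurable_fun setT (B t : T -> borel_gpts G K) &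
      (forall w, B 0%N w = b 0%N w) /\
      (forall t w, B t.+1 w =
         B t w * b' t.+1 w * torus_elt G varpi0 (- walk_incr W t w) * b t.+1 w)%g].

Definition N_part (W : nat -> T -> 'rV[int]_n) (B N : nat -> T -> gpts G K) :
    Prop :=
  forall t w, Ngrp Delta G K (N t w) /\
    exists2 c, TO G K c &
      B t w = (N t w * torus_elt G varpi0 (- W t w) * c)%g.

Definition almost_sure_limit (N : nat -> T -> gpts G K) (Ninf : T -> gpts G K) :
    Prop :=
  [/\ measurable_fun setT (Ninf : T -> borel_gpts G K),
      forall w, Ngrp Delta G K (Ninf w) &
      {ae P, forall w, (fun t => N t w) @ \oo --> Ninf w}].

End RandomWalk.

End Probability.

(* Main.v *)
(* Write F_t for (chi^-1 psi_chi)(varpi^-lambda B_t). Decomposing B_t along N T(O),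
   equivariance gives F_t = phi_N(varpi^-lambda N_t varpi^lambda) g(lambda + W_t)
   with g(mu) = (chi^-1 psi_chi)(varpi^-mu), and E[F_t] does not depend on t.
   The walk escapes to infinity inside the open dual chamber, so g(lambda + W_t)
   tends to L = b(z) e^<z,rho> and bounded convergence gives the formula.

   Escape: with p the law of the increments and s_a a simple reflection,
   p(s_a mu) = p(mu) e^(-<a,mu><z,a^vee>), so with theta = <z,a^vee>/2 the function
   e^(-theta <a,mu>) p(mu) is the geometric mean of p and p o s_a, of sum r < 1.
   Hence E e^(-theta <a,W_t>) = r^t is summable, and <a,W_t> -> +oo a.s. That
   <a,.> is not identically 0 on the orbit of Lambda is where minusculity enters.

   Regularity: phi_N is only given by its values on root subgroups, but if L <> 0
   some psi_chi(y) is non-zero, and phi_N(n) = psi_chi(n y) / psi_chi(y) is locally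
   constant; if L = 0 the regularity of phi_N is irrelevant. *)
Require Import Defs.
From HB Require Import structures.
From mathcomp Require Import all_boot all_order all_algebra.
From mathcomp Require Import complex.
From mathcomp Require Import all_classical all_reals all_analysis.
From mathcomp Require Import ring lra measurable_realfun.

Set Implicit Arguments.
Unset Strict Implicit.
Unset Printing Implicit Defensive.

Import Order.TTheory GRing.Theory Num.Theory.
Import numFieldNormedType.Exports.

Local Open Scope classical_set_scope.
Local Open Scope ring_scope.

(** * Root data *)

Lemma ipairDr n (x y z : 'rV[int]_n) : ipair z (x + y) = ipair z x + ipair z y.
Proof. by rewrite !(ipairC z) ipairDl. Qed.

Lemma ipairNr n (x z : 'rV[int]_n) : ipair z (- x) = - ipair z x.
Proof.
by rewrite /ipair -sumrN; apply: eq_bigr => k _; rewrite mxE mulrN.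
Qed.

Lemma ipairZr n (x z : 'rV[int]_n) (c : int) : ipair z (x *~ c) = ipair z x * c.
Proof.
rewrite /ipair mulr_suml; apply: eq_bigr => k _.
by rewrite -scaler_int mxE intz mulrCA mulrC.
Qed.

Lemma ipair_sumr n (I : finType) (x : I -> 'rV[int]_n) (z : 'rV[int]_n) :
  ipair z (\sum_i x i) = \sum_i ipair z (x i).
Proof.
apply: (big_morph (ipair z)) => [x1 x2|]; first exact: ipairDr.
by rewrite ipairC ipair0l.
Qed.

Lemma ipair_mulmx m n (x : 'rV[int]_m) (y : 'rV[int]_n) (F : 'M[int]_(m, n)) :
  ipair x (y *m F^T) = ipair (x *m F) y.
Proof.
rewrite /ipair.
under eq_bigr do rewrite mxE big_distrr /=.
under [RHS]eq_bigr do rewrite mxE big_distrl /=.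
rewrite exchange_big; apply: eq_bigr => i _; apply: eq_bigr => j _.
by rewrite !mxE mulrA mulrAC mulrC mulrA.
Qed.

Section RootData.
Variables (n : nat) (D : root_datum n).
Implicit Types (i j : rd_index D) (x y mu : 'rV[int]_n).

Definition coweight_refl i mu := mu - coroot_of i *~ ipair (root_of i) mu.

Lemma ipair_refl i mu :
  ipair (root_of i) (coweight_refl i mu) = - ipair (root_of i) mu.
Proof. by rewrite /coweight_refl ipairDr ipairNr ipairZr root_coroot2; ring. Qed.

Lemma reflK i : involutive (coweight_refl i).
Proof.
by move=> mu; rewrite {1}/coweight_refl ipair_refl mulrNz opprK subrK.
Qed.

Lemma weyl_orbit_refl_iff (lam : 'rV[int]_n) i mu :
  weyl_orbit D lam (coweight_refl i mu) <-> weyl_orbit D lam mu.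
Proof.
split=> h; last exact: weyl_orbit_step.
by rewrite -[mu](reflK i); exact: weyl_orbit_step.
Qed.

(** The usual Weyl-invariant symmetric form on characters, built from all coroots so that it stays
    integer valued. *)
Definition root_form x y : int :=
  \sum_(k : rd_index D) ipair x (coroot_of k) * ipair y (coroot_of k).

Definition char_refl i x := x - root_of i *~ ipair x (coroot_of i).

Lemma char_refl_adj i x mu :
  ipair (char_refl i x) mu = ipair x (coweight_refl i mu).
Proof.
rewrite /char_refl /coweight_refl ipairDr ipairNr ipairZr.
by rewrite [LHS]ipairC ipairDr ipairNr ipairZr !(ipairC mu); ring.
Qed.

(** A reflection permutes the coroots: [coroot_refl] provides the map [s] on indices, and [s] is
    injective because reflections are involutions. Invariance is then a reindexing of the sum. *)
Lemma root_form_refl i x y :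
  root_form (char_refl i x) (char_refl i y) = root_form x y.
Proof.
have [s sE] := choice (coroot_refl i).
have s_inj : injective s.
  move=> j k /(congr1 (@coroot_of n D)); rewrite !sE.
  by move=> /(can_inj (reflK i))/coroot_inj.
rewrite /root_form [RHS](reindex_inj s_inj) /=.
by apply: eq_bigr => k _; rewrite sE !char_refl_adj.
Qed.

(** The classical identity [<x, a^vee> = 2 (x, a) / (a, a)]. It comes from invariance under the
    reflection in [a], which sends [a] to [-a]. *)
Lemma root_form_coroot i x :
  ipair x (coroot_of i) * root_form (root_of i) (root_of i) =
  2 * root_form x (root_of i).
Proof.
have e : root_form (char_refl i x) (char_refl i (root_of i)) =
    ipair x (coroot_of i) * root_form (root_of i) (root_of i)
    - root_form x (root_of i).
  rewrite /root_form mulr_sumr -sumrB; apply: eq_bigr => k _.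
  rewrite /char_refl root_coroot2 !(ipairC _ (coroot_of k)).
  by rewrite !(ipairDr, ipairNr, ipairZr); ring.
by rewrite mulr_natl mulr2n -[X in _ = X + _](root_form_refl i) e subrK.
Qed.

Lemma root_form_gt0 i : 0 < root_form (root_of i) (root_of i).
Proof.
rewrite /root_form (bigD1 i)//= root_coroot2 ltr_pwDl// sumr_ge0// => k _.
by rewrite -expr2 sqr_ge0.
Qed.

(** As [(a, a) > 0], each pairing vanishes exactly when [root_form] does on the two roots, and
    [root_form] is symmetric. *)
Lemma ipair_root_coroot_eq0 i j :
  (ipair (root_of i) (coroot_of j) == 0) = (ipair (root_of j) (coroot_of i) == 0).
Proof.
have h (k l : rd_index D) : ipair (root_of k) (coroot_of l) = 0 ->
    root_form (root_of k) (root_of l) = 0.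
  move=> e; have := root_form_coroot l (root_of k); rewrite e mul0r.
  by move=> /esym/eqP; rewrite mulf_eq0 => /eqP.
have h' (k l : rd_index D) : root_form (root_of k) (root_of l) = 0 ->
    ipair (root_of k) (coroot_of l) = 0.
  move=> e; have := root_form_coroot l (root_of k); rewrite e mulr0.
  by move=> /eqP; rewrite mulf_eq0 (gt_eqF (root_form_gt0 l)) orbF => /eqP.
have formC (k l : rd_index D) :
    root_form (root_of k) (root_of l) = root_form (root_of l) (root_of k).
  by apply: eq_bigr => m _; rewrite mulrC.
by apply/eqP/eqP => /h; rewrite formC => /h'.
Qed.

(** Orthogonality travels along an edge from [i] to [k]: pairing root [i] with the reflection of
    [mu] in [k] gives [<k, mu> <i, k^vee> = 0], and adjacency makes the second factor non-zero. *)
Lemma orbit_orthogonal_connect lam i j : connect (@root_adj n D) i j ->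
  (forall mu, weyl_orbit D lam mu -> ipair (root_of i) mu = 0) ->
  forall mu, weyl_orbit D lam mu -> ipair (root_of j) mu = 0.
Proof.
move=> /connectP[p]; elim: p i => [i _ -> //|k p IH i /= /andP[ik kp] jE h].
apply: IH kp jE _ => mu mu_orb.
have ik0 : ipair (root_of i) (coroot_of k) != 0.
  by move: ik; rewrite /root_adj -(ipair_root_coroot_eq0 i k) orbb.
have := h _ (weyl_orbit_step k mu_orb).
rewrite ipairDr ipairNr ipairZr h// add0r => /eqP.
by rewrite oppr_eq0 mulf_eq0 (negPf ik0) => /eqP.
Qed.

(** If root [i] were orthogonal to the whole orbit, so would be every root of its irreducible
    component. These roots span the character lattice of the factor, so the component of [lam] there
    would be zero, which minusculity forbids. *)
Lemma minuscule_orbit_pairing (R : realType) (Delta : {set rd_index D})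
    (lam : 'rV[int]_n) i : minuscule R Delta lam ->
  exists2 mu, weyl_orbit D lam mu & ipair (root_of i) mu != 0.
Proof.
move=> /(_ i)[m [D' [e [F [[_ eJ eroot _ span] [_ lam0 _]]]]]].
apply: contrapT => noorb.
have orth mu : weyl_orbit D lam mu -> ipair (root_of i) mu = 0.
  by move=> mu_orb; apply/eqP/negP => ne; apply: noorb; exists mu => //; apply/negP.
move/eqP: lam0; apply; apply/rowP => k; rewrite [RHS]mxE.
(* The [k]-th coordinate of the component is its pairing with the [k]-th basis character, itself an
   integral combination of roots. *)
have [c cE] := span (delta_mx 0 k).
have <- : ipair (delta_mx 0 k) (lam *m F^T) = (lam *m F^T) 0 k.
  rewrite /ipair (bigD1 k)//= big1 ?mxE ?eqxx ?mul1r ?addr0// => l /negPf lk.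
  by rewrite mxE lk mul0r.
have -> : ipair (delta_mx 0 k) (lam *m F^T) =
    \sum_j c j * ipair (root_of (e j)) lam.
  rewrite cE ipairC ipair_sumr.
  by apply: eq_bigr => j _; rewrite ipairZr ipairC ipair_mulmx -eroot mulrC.
apply: big1 => j _; rewrite (@orbit_orthogonal_connect lam i (e j)) ?mulr0//.
- by have /eJ : exists l, e l = e j by [exists j]; rewrite inE.
- exact: weyl_orbit_refl.
Qed.

End RootData.

(** * Escape of the walk *)

Section CountableVariable.
Context {d : measure_display} {T : measurableType d} {R : realType}.
Variable P : probability T R.
Local Open Scope ereal_scope.

(** For [r] non-zero, the inequality [half] used for [r^-1] and the scaled family yields the
    converse inequality. *)
Lemma esumZl (I : choiceType) (J : set I) (a : I -> \bar R) (r : R) :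
  (0 <= r)%R -> (forall i, 0 <= a i) ->
  \esum_(i in J) (r%:E * a i) = r%:E * \esum_(i in J) a i.
Proof.
have half (s : R) (b : I -> \bar R) : (0 <= s)%R -> (forall i, 0 <= b i) ->
    \esum_(i in J) (s%:E * b i) <= s%:E * \esum_(i in J) b i.
  move=> s0 b0; apply: ge_ereal_sup => _ [F [finF FJ] <-].
  rewrite -ge0_mule_fsumr//; apply: lee_wpmul2l; first by rewrite lee_fin.
  by apply: ereal_sup_ubound; exists F.
move=> r0 a0; have [->|rn0] := eqVneq r 0%R.
  by rewrite mul0e esum1// => i _; rewrite mul0e.
have rp : (0 < r)%R by rewrite lt_neqAle eq_sym rn0.
apply/eqP; rewrite eq_le half//=.
have b0 i : 0 <= r%:E * a i by rewrite mule_ge0.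
have ri : (0 <= r^-1)%R by rewrite invr_ge0.
have := half r^-1%R _ ri b0.
under [leLHS]eq_esum do rewrite muleA -EFinM mulVf// mul1e.
move=> /(@lee_wpmul2l _ r%:E); rewrite lee_fin => /(_ r0).
by rewrite muleA -EFinM mulfV// mul1e.
Qed.

Variables (C : countType) (X : T -> C).
Hypothesis mX : forall c, measurable [set w | X w = c].

Lemma measurable_countable_preimage (S : set C) : measurable (X @^-1` S).
Proof.
have -> : X @^-1` S = \bigcup_(k : nat)
    (if unpickle k is Some c then [set w | X w = c /\ S c] else set0).
  apply/seteqP; split=> [w Sw|w [k _]].
    by exists (pickle (X w)) => //; rewrite pickleK.
  by case: unpickle => // c [<-].
apply: bigcupT_measurable => k; case: unpickle => [c|]//.
have [Sc|nSc] := pselect (S c); last first.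
  by rewrite (_ : mkset _ = set0)//; apply/seteqP; split=> // w [].
by rewrite (_ : mkset _ = [set w | X w = c])//; apply/seteqP; split=> // w [].
Qed.

(** Countable additivity is applied to level sets indexed by the codes [pickle c]; integers that are
    not codes give empty sets. *)
Lemma ge0_integral_countable (A : set T) (f : T -> \bar R) : measurable A ->
  measurable_fun A f -> (forall w, 0 <= f w) ->
  \int[P]_(w in A) f w =
  \esum_(c in [set: C]) \int[P]_(w in A `&` [set w | X w = c]) f w.
Proof.
move=> mA mf f0.
pose F k := A `&` [set w | pickle (X w) = k].
have AE : A = \bigcup_k F k.
  by apply/seteqP; split=> [w Aw|w [k _ []]//]; exists (pickle (X w)).
have mF k : measurable (F k).
  apply: measurableI => //.
  exact: (measurable_countable_preimage [set c | pickle c = k]).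
rewrite {1}AE ge0_integral_bigcup//; last 2 first.
- by rewrite -AE.
- by move=> i j _ _ [w [[_ <-] [_ <-]]].
rewrite nneseries_esumT; last by move=> k; exact: integral_ge0.
rewrite (esumID (range (@pickle C))); last by move=> k _; exact: integral_ge0.
rewrite setTI [X in _ + X]esum1 ?adde0; last first.
  move=> k [_ nk]; rewrite (_ : F k = set0) ?integral_set0//.
  by apply/seteqP; split=> // w [_ kE]; apply: nk; exists (X w).
rewrite esum_image; last by move=> c c' _ _; exact: (pcan_inj pickleK).
apply: eq_esum => c _; congr (integral _ _ _).
apply/seteqP; split=> w [Aw] /=; last by move=> XE; split=> //=; rewrite XE.
by move=> /(pcan_inj pickleK).
Qed.

End CountableVariable.

(** * Multiplicative functions along a walk with independent increments *)

Section RandomWalkEscape.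
Context {d : measure_display} {T : measurableType d} {R : realType}.
Variable P : probability T R.
Variables (n : nat) (W : nat -> T -> 'rV[int]_n).
Local Notation X := (walk_incr W).
Hypothesis mW : forall t mu, measurable [set w | W t w = mu].
Hypothesis W0 : forall w, W 0%N w = 0.
Hypothesis indepX : independent_family P
  (fun t => [set X t @^-1` A | A in setT]).
Variable p : 'rV[int]_n -> R.
Hypothesis lawX : forall t mu, P [set w | X t w = mu] = (p mu)%:E.

Lemma measurable_walk_incr t mu : measurable [set w | X t w = mu].
Proof.
rewrite (_ : mkset _ = [set w | (W t w, W t.+1 w).2 - (W t w, W t.+1 w).1 = mu])//.
apply: (@measurable_countable_preimage _ _ _ (fun w => (W t w, W t.+1 w)) _
  [set c | c.2 - c.1 = mu]) => -[a b].
rewrite (_ : mkset _ = [set w | W t w = a] `&` [set w | W t.+1 w = b]).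
  exact: measurableI.
by apply/seteqP; split=> w /= [-> ->].
Qed.

(** Finite product events in the increments from time [t] on. The induction below peels increments
    off [W t] and stores them in such an event, so that the product formula of [independent_family]
    applies directly. *)
Definition future_event (t : nat) (B : set T) : Prop :=
  exists (s : seq nat) (A : nat -> set T),
    [/\ uniq s, forall i, i \in s -> (t <= i)%N /\ exists S, A i = X i @^-1` S &
      B = \bigcap_(i in [set` s]) A i].

Lemma future_eventP t B : future_event t.+1 B ->
  forall mu, future_event t (B `&` [set w | X t w = mu]) /\
    P (B `&` [set w | X t w = mu]) = (P B * (p mu)%:E)%E.
Proof.
move=> [s [A [us As ->]]] mu.
pose A' i := if i == t then [set w | X t w = mu] else A i.
have ts : t \notin s by apply/negP => /As[]; rewrite ltnn.
have A'E i : i \in s -> A' i = A i.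
  by rewrite /A'; case: eqP => // ->; rewrite (negPf ts).
have BE : \bigcap_(i in [set` s]) A i `&` [set w | X t w = mu] =
    \bigcap_(i in [set` t :: s]) A' i.
  apply/seteqP; split=> [w [Bw Xw] i /=|w Bw].
    rewrite inE => /orP[/eqP ->|si]; first by rewrite /A' eqxx.
    by rewrite A'E//; exact: Bw.
  split=> [i /= si|]; first by rewrite -A'E//; apply: Bw; rewrite /= inE si orbT.
  by have := Bw t; rewrite /A' eqxx; apply; rewrite /= mem_head.
have us' : uniq (t :: s) by rewrite /= ts.
have As' i : i \in t :: s -> (t <= i)%N /\ exists S, A' i = X i @^-1` S.
  rewrite inE => /orP[/eqP ->|si].
    by split=> //; exists [set mu]; rewrite /A' eqxx.
  by rewrite A'E//; have [/ltnW] := As _ si.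
split; first by exists (t :: s), A'; split.
rewrite BE indepX//; last first.
  by move=> i /As'[_ [S ->]]; exists S.
rewrite big_cons {1}/A' eqxx lawX indepX//; last first.
  by move=> i /As[_ [S ->]]; exists S.
by rewrite muleC; congr (_ * _)%E; apply: eq_big_seq => i /A'E ->.
Qed.

Lemma future_event_measurable t B : future_event t B -> measurable B.
Proof.
move=> [s [A [_ As ->]]]; apply: bigcap_measurableType => i si.
have [_ [S ->]] := As i si.
exact/measurable_countable_preimage/measurable_walk_incr.
Qed.

Variable h : 'rV[int]_n -> R.
Hypothesis h0 : h 0 = 1.
Hypothesis hD : forall mu nu, h (mu + nu) = h mu * h nu.
Hypothesis h_ge0 : forall mu, 0 <= h mu.
Variable r : R.
Hypothesis rE : (\esum_(mu in [set: 'rV[int]_n]) (h mu * p mu)%:E = r%:E)%E.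

Lemma measurable_fun_walk t (A : set T) (f : 'rV[int]_n -> R) :
  measurable A -> measurable_fun A (fun w => (f (W t w))%:E).
Proof.
move=> mA _ B _; apply: measurableI => //.
exact: (measurable_countable_preimage (mW t) [set mu | B (f mu)%:E]).
Qed.

(** Induction on [t] with [B] arbitrary. On [X t = mu] one has [h (W t.+1) = h mu * h (W t)], and
    [B] cut by [X t = mu] is a future event from time [t], of probability [P B * p mu]. Summing over
    [mu] produces one more factor [r]. *)
Lemma integral_walk_multiplicative t B : future_event t B ->
  (\int[P]_(w in B) (h (W t w))%:E = P B * (r ^+ t)%:E)%E.
Proof.
elim: t B => [|t IH] B fB; have mB := future_event_measurable fB.
  under eq_integral do rewrite W0 h0.
  by rewrite integral_cst// expr0 muleC.
have Bmu := future_eventP fB.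
have PBge0 : (0 <= P B)%E by exact: measure_ge0.
have PBfin : P B \is a fin_num by exact: fin_num_measure.
have p_ge0 mu : 0 <= p mu by rewrite -lee_fin -(lawX 0); exact: measure_ge0.
have r_ge0 : 0 <= r.
  by rewrite -lee_fin -rE esum_ge0// => mu _; rewrite lee_fin mulr_ge0.
rewrite (@ge0_integral_countable _ _ _ P _ (X t))//; last 3 first.
- exact: measurable_walk_incr.
- exact: measurable_fun_walk.
- by move=> w; rewrite lee_fin.
transitivity (\esum_(mu in [set: 'rV[int]_n])
    ((fine (P B) * r ^+ t)%:E * (h mu * p mu)%:E))%E; last first.
  rewrite esumZl ?rE; last 2 first.
  + by rewrite mulr_ge0 ?exprn_ge0// fine_ge0.
  + by move=> mu; rewrite lee_fin mulr_ge0.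
  by rewrite -{2}(fineK PBfin) -!EFinM exprSr mulrA.
apply: eq_esum => mu _; have [fBmu PBmu] := Bmu mu.
have mBmu := future_event_measurable fBmu.
transitivity (\int[P]_(w in B `&` [set w | X t w = mu])
    ((h mu)%:E * (h (W t w))%:E))%E.
  apply: eq_integral => w /set_mem[_ /= <-].
  by rewrite -EFinM -hD /walk_incr subrK.
rewrite ge0_integralZl_EFin//; last 2 first.
- by move=> w _; rewrite lee_fin.
- exact: measurable_fun_walk.
rewrite IH// PBmu -(fineK PBfin) -!EFinM; congr (_%:E); ring.
Qed.

(* Markov and Borel-Cantelli in one step: the sum over t of h(W_t) has the
   finite expectation 1 / (1 - r). *)
Lemma walk_multiplicative_cvg0 : r < 1 ->
  {ae P, forall w, (fun t => h (W t w)) @ \oo --> (0 : R)}.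
Proof.
move=> r1.
have p_ge0 mu : 0 <= p mu by rewrite -lee_fin -(lawX 0); exact: measure_ge0.
have r_ge0 : 0 <= r.
  by rewrite -lee_fin -rE esum_ge0// => mu _; rewrite lee_fin mulr_ge0.
have fT t : future_event t setT.
  by exists [::], (fun=> setT); split=> //; apply/seteqP; split=> // w _ i.
pose f w := (\sum_(t <oo) (h (W t w))%:E)%E.
have mh t : measurable_fun setT (fun w => (h (W t w))%:E).
  exact: measurable_fun_walk.
have h_ge0E t w : (0 <= (h (W t w))%:E)%E by rewrite lee_fin.
have intf : (\int[P]_w f w < +oo)%E.
  rewrite integral_nneseries//.
  under eq_eseriesr do
    rewrite integral_walk_multiplicative// probability_setT mul1e.
  apply: (@le_lt_trans _ _ ((1 - r)^-1)%:E); last exact: ltry.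
  apply: lime_le.
    by apply: is_cvg_nneseries => t _ _; rewrite lee_fin exprn_ge0.
  apply: nearW => N.
  have -> : (\sum_(0 <= t < N) (r ^+ t)%:E = (series (geometric 1 r) N)%:E)%E.
    by rewrite /series /= -sumEFin; apply: eq_bigr => t _; rewrite mul1r.
  rewrite geometric_seriesE ?lt_eqF//= mul1r lee_fin ler_piMl//.
    by rewrite invr_ge0 subr_ge0 ltW.
  by rewrite gerBl exprn_ge0.
have : P.-integrable setT f.
  apply/integrableP; split; first exact: ge0_emeasurable_sum.
  apply: le_lt_trans intf; rewrite le_eqVlt; apply/orP; left; apply/eqP.
  by apply: eq_integral => w _; rewrite gee0_abs// nneseries_ge0.
move=> /(integrable_ae measurableT); apply: filterS => w /(_ I) fw.
have sw : summable [set: nat] (fun t => (h (W t w))%:E).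
  rewrite summableE -nneseries_esumT//.
  by under eq_eseriesr do rewrite gee0_abs//.
have := @summable_cvg R xpredT (fun t => (h (W t w))%:E) (fun t _ => h_ge0E t w).
move=> cw; apply: (@cvg_series_cvg_0 _ R^o); apply: cw.
rewrite [X in summable X](_ : _ = setT)//; exact/seteqP.
Qed.

End RandomWalkEscape.

(** * Escape of the weight walk along a root *)

Section WeightWalkEscape.
Variables (R : realType) (n : nat) (D : root_datum n).
Implicit Types (z : 'rV[R]_n) (a : rd_index D).

Lemma rpair_real_vectD z (mu nu : 'rV[int]_n) : rpair z (real_vect R (mu + nu)) =
  rpair z (real_vect R mu) + rpair z (real_vect R nu).
Proof.
rewrite /rpair -big_split; apply: eq_bigr => k _ /=.
by rewrite !mxE rmorphD mulrDr.
Qed.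

Lemma rpair_real_vectNZ z (mu : 'rV[int]_n) (c : int) :
  rpair z (real_vect R (- (mu *~ c))) = - (rpair z (real_vect R mu) * c%:~R).
Proof.
rewrite /rpair mulr_suml -sumrN; apply: eq_bigr => k _ /=.
by rewrite -scaler_int !mxE intz rmorphN rmorphM /=; ring.
Qed.

Context {d : measure_display} {T : measurableType d} (P : probability T R).

Lemma weight_walk_escape (Lam : 'rV[int]_n) z (ch : R)
    (W : nat -> T -> 'rV[int]_n) a :
  weight_walk P D Lam z ch W ->
  0 < rpair z (real_vect R (coroot_of a)) ->
  (exists2 mu, weyl_orbit D Lam mu & ipair (root_of a) mu != 0) ->
  {ae P, forall w, forall M : int,
    \forall t \near \oo, M <= ipair (root_of a) (W t w)}.
Proof.
move=> [mW W0 indepX lawX0]; set c := rpair z _ => c0 [mu0 orb0 m0].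
pose p mu := if `[< weyl_orbit D Lam mu >]
  then expR (rpair z (real_vect R mu)) / ch else 0.
have lawX t mu : P [set w | walk_incr W t w = mu] = (p mu)%:E.
  have [in_orb out_orb] := lawX0 t mu.
  by rewrite /p; case: asboolP => [/in_orb|/out_orb].
have p_ge0 mu : 0 <= p mu by rewrite -lee_fin -(lawX 0%N); exact: measure_ge0.
have sum_p : (\esum_(mu in [set: 'rV[int]_n]) (p mu)%:E = 1)%E.
  have <- : (\int[P]_(w in setT) (cst 1 w) = 1)%E.
    by rewrite integral_cst// mul1e; exact: probability_setT.
  rewrite (@ge0_integral_countable _ _ _ P _ (walk_incr W 0%N)
    (measurable_walk_incr mW 0%N))//.
  apply: eq_esum => mu _; rewrite setTI -(lawX 0%N) integral_cst ?mul1e//.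
  exact: measurable_walk_incr.
(* Division by zero returns zero, so [ch = 0] would make [p] vanish identically, against its total
   mass 1. *)
have ch0 : ch != 0.
  apply/eqP => ch0; have := sum_p; rewrite esum1 => [/esym/eqP|mu _].
    by rewrite onee_eq0.
  by rewrite /p ch0 invr0 mulr0 if_same.
pose m mu : R := (ipair (root_of a) mu)%:~R.
pose h mu := expR (- (c / 2) * m mu).
have mD mu nu : m (mu + nu) = m mu + m nu by rewrite /m ipairDr rmorphD.
have hD mu nu : h (mu + nu) = h mu * h nu by rewrite /h mD mulrDr expRD.
have h0 : h 0 = 1 by rewrite /h /m ipairC ipair0l mulr0 expR0.
have h_ge0 mu : 0 <= h mu by exact: expR_ge0.
have p_refl mu : p (coweight_refl a mu) = p mu * h mu ^+ 2.
  rewrite /p; have -> : `[< weyl_orbit D Lam (coweight_refl a mu) >] =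
      `[< weyl_orbit D Lam mu >] by apply/asbool_equiv_eq/weyl_orbit_refl_iff.
  case: ifP => _; last by rewrite mul0r.
  rewrite /coweight_refl rpair_real_vectD rpair_real_vectNZ -/c -/(m mu) expRD.
  rewrite /h -expRM_natl [RHS]mulrAC; congr (_ * expR _ / _); lra.
have sum_p_refl :
    (\esum_(mu in [set: 'rV[int]_n]) (p (coweight_refl a mu))%:E = 1)%E.
  rewrite -sum_p [RHS](reindex_esum setT setT (coweight_refl a))//.
  split=> // [mu1 mu2 _ _|mu _]; first exact: (can_inj (reflK a)).
  by exists (coweight_refl a mu) => //; rewrite reflK.
(* The defect in the arithmetic-geometric inequality between [p mu] and its reflected value
   [p mu * h mu ^+ 2]. *)
pose q mu := p mu * (1 - h mu) ^+ 2.
have q_ge0 mu : 0 <= q mu by rewrite mulr_ge0// sqr_ge0.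
have hp_ge0 mu : 0 <= h mu * p mu by rewrite mulr_ge0.
(* AM-GM: 2 h p = p + p \o coweight_refl a - q, where h p is the geometric mean. *)
have amgm : (2%:E * (\esum_(mu in [set: 'rV[int]_n]) (h mu * p mu)%:E) +
    (\esum_(mu in [set: 'rV[int]_n]) (q mu)%:E) = 2%:E)%E.
  rewrite -esumZl//.
  rewrite -esumD; last 2 first.
  - by move=> mu _; rewrite mule_ge0 ?lee_fin.
  - by move=> mu _; rewrite lee_fin.
  rewrite [RHS](_ : _ = 1 + 1)%E; last by rewrite -EFinD.
  rewrite -{1}sum_p -sum_p_refl -esumD; last 2 first.
  - by move=> mu _; rewrite lee_fin.
  - by move=> mu _; rewrite lee_fin.
  apply: eq_esum => mu _; rewrite -EFinM -!EFinD p_refl /q; congr (_%:E); ring.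
(* Strictness: [mu0] lies in the orbit, so [p mu0 > 0], and its non-zero pairing with the root gives
   [h mu0 != 1]. *)
have q0 : 0 < q mu0.
  rewrite /q mulr_gt0//.
    rewrite lt_neqAle p_ge0 eq_sym /p asboolT// andbT mulf_neq0 ?invr_eq0//.
    by rewrite gt_eqF ?expR_gt0.
  rewrite exprn_even_gt0//= subr_eq0 -expR0 eq_sym.
  rewrite (inj_eq (@expR_inj R)) mulf_neq0//.
    by rewrite oppr_eq0 mulf_neq0 ?gt_eqF ?invr_gt0.
  by rewrite intr_eq0.
have qE : ((q mu0)%:E <= \esum_(mu in [set: 'rV[int]_n]) (q mu)%:E)%E.
  apply: esum_ge; exists [set mu0]; last by rewrite fsbig_set1.
  by split=> //; exact: finite_set1.
have sum_hp0 : (0 <= \esum_(mu in [set: 'rV[int]_n]) (h mu * p mu)%:E)%E.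
  by apply: esum_ge0 => mu _; rewrite lee_fin.
(* Both sums are non-negative and [amgm] bounds them, hence they are finite, say [r] and [s]. Then
   [2 r + s = 2] with [s >= q mu0 > 0]. *)
have [r rE r1] : exists2 r,
    (\esum_(mu in [set: 'rV[int]_n]) (h mu * p mu)%:E = r%:E)%E & r < 1.
  move: amgm qE sum_hp0.
  case: (esum _ _) => [r||]; case: (esum _ _) => [s||]//=.
  - rewrite -EFinM -EFinD => -[rs]; rewrite !lee_fin => qs r_ge0; exists r => //.
    lra.
  - by rewrite mulry gtr0_sg// mul1e.
  - by rewrite mulry gtr0_sg// mul1e.
have := @walk_multiplicative_cvg0 _ _ _ P _ W mW W0 indepX p lawX h h0 hD h_ge0
  r rE r1.
apply: filterS => w hw M.
(* Since [- (c / 2) < 0], the bound of [h (W t w)] by this exponential says that the pairing of the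
   root with [W t w] exceeds [M]. *)
have /(cvgr_lt _) := hw; move=> /(_ (expR (- (c / 2) * M%:~R)) (expR_gt0 _)).
apply: filterS => t; rewrite ltr_expR ltr_nM2l ?ltr_int => [/ltW//|].
by rewrite oppr_lt0 divr_gt0.
Qed.

End WeightWalkEscape.

(** * Continuity of translations on G(K) *)

Section Valuation.
Variable K : localFieldType.

Lemma valuation1 : valuation (1 : K) = 0.
Proof.
by apply: (addrI (valuation (1 : K))); rewrite -Defs.valM ?oner_neq0// mulr1 addr0.
Qed.

Lemma vgeN (a : K) m : vge a m -> vge (- a) m.
Proof.
have [->|a0] := eqVneq a 0; first by rewrite oppr0.
have N1 : (-1 : K) != 0 by rewrite oppr_eq0 oner_neq0.
have vN1 : valuation (-1 : K) = 0.
  have : valuation (-1 : K) + valuation (-1 : K) = 0.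
    by rewrite -Defs.valM// mulrNN mulr1 valuation1.
  by rewrite -mulr2n => /eqP; rewrite mulrn_eq0 => /eqP.
by rewrite /vge /vge_of oppr_eq0 -mulN1r Defs.valM// vN1 add0r.
Qed.

Lemma vgeM (a b : K) m l : vge a m -> vge b l -> vge (a * b) (m + l).
Proof.
rewrite /vge /vge_of mulf_eq0.
have [->//|a0] := eqVneq a 0; have [->//|b0] /= := eqVneq b 0.
by rewrite Defs.valM//; exact: lerD.
Qed.

Lemma vge_val (a : K) : exists m, vge a m.
Proof. by exists (valuation a); rewrite /vge /vge_of lexx orbT. Qed.

End Valuation.

Section ContinuousFunctions.
Variables (X : topologicalType) (K : localFieldType).

Lemma cvg_vgeP (f : X -> K) x :
  f @ x --> f x <-> forall m, \forall y \near x, vge (f y - f x) m.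
Proof.
split=> [fx m|fx A /nbhs_val[m mA]].
  by apply: (fx [set b | vge (b - f x) m]); apply/nbhs_val; exists m.
by apply: filterS (fx m) => y; exact: mA.
Qed.

(** A boolean predicate, so that continuous functions can be made into a subring type over which [G]
    has points. *)
Definition continuous_pred : {pred (X -> K)} :=
  fun f => `[< continuous (f : X -> K) >].

End ContinuousFunctions.

Section ContinuousRing.
Variables (X : ptopologicalType) (K : localFieldType).

Fact continuous_subring : subring_closed (@continuous_pred X K).
Proof.
split.
- apply/asboolP => x; exact: cvg_cst.
- move=> f g /asboolP cf /asboolP cg; apply/asboolP => x; apply/cvg_vgeP => m.
  have /cvg_vgeP/(_ m) fx := cf x; have /cvg_vgeP/(_ m) gx := cg x.
  near=> y.
  have -> : (f - g) y - (f - g) x = (f y - f x) + - (g y - g x).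
    by rewrite -[LHS]/(f y - g y - (f x - g x)); ring.
  by apply: Defs.valD; [near: y|apply: vgeN; near: y].
- move=> f g /asboolP cf /asboolP cg; apply/asboolP => x; apply/cvg_vgeP => m.
  have [k fk] := vge_val (f x); have [l gl] := vge_val (g x).
  have /cvg_vgeP fx := cf x; have /cvg_vgeP gx := cg x.
  near=> y.
  (* With [f x] and [g x] of order at least [k] and [l], the increments are small to orders 0 and
     [m] in the first term, and to orders [m - k] and [m - l] in the other two. *)
  have -> : (f * g) y - (f * g) x = (f y - f x) * (g y - g x) +
      (f x * (g y - g x) + (f y - f x) * g x).
    by rewrite -[LHS]/(f y * g y - f x * g x); ring.
  apply: Defs.valD; [|apply: Defs.valD].
  + rewrite -[m]add0r; apply: vgeM; first by near: y; exact: fx.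
    by near: y; exact: gx.
  + rewrite -[m](subrKC k); apply: vgeM => //; near: y; exact: gx.
  + rewrite -[m](subrK l); apply: vgeM => //; near: y; exact: fx.
Unshelve. all: by end_near. Qed.

HB.instance Definition _ :=
  GRing.isSubringClosed.Build (X -> K) (@continuous_pred X K) continuous_subring.

End ContinuousRing.

(** * Multiplication on G(K) through points over rings of continuous functions *)

Section Translations.
Variables (G : affine_group) (K : localFieldType).
Local Notation X := (gpts G K).

Lemma gpts_eval_continuous a : continuous (fun h : X => ag_eval h a).
Proof.
move=> h.
have c1 : {for h, continuous (@ag_eval G K : X -> {ptws ag_coord G -> K})}.
  exact: initial_continuous.
exact: (continuous_comp c1 (@proj_continuous _ (fun=> K) a _)).
Qed.

Lemma gpts_continuous (Y : topologicalType) (f : Y -> X) :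
  (forall a, continuous (fun y => ag_eval (f y) a)) -> continuous f.
Proof.
move=> fc; apply: continuous_comp_initial => y.
apply/cvg_sup => a.
move=> A [_ [[U oU <-]] /= Uy UA]; apply: filterS UA _.
by apply: (fc a y); apply: open_nbhs_nbhs; split.
Qed.

Lemma gpts_eq (R : comNzRingType) (g h : gpts G R) :
  (forall a, ag_eval g a = ag_eval h a) -> g = h.
Proof.
case: g h => g [[gB] [gM]] [h [[hB] [hM]]] /funext /= e.
rewrite /ag_eval /= in e; subst h.
by rewrite (Prop_irrelevance gB hB) (Prop_irrelevance gM hM).
Qed.

(** The group law is given on points and is natural in the ring, with no explicit comultiplication.
    A point over this ring is a [K]-point varying continuously, so naturality can replace polynomial
    formulas. *)
Definition continuous_fun : Type := {f : X -> K | f \in @continuous_pred X K}.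

HB.instance Definition _ := SubChoice.on continuous_fun.
HB.instance Definition _ := [SubChoice_isSubComNzRing of continuous_fun by <:].

Definition eval_at (h : X) (f : continuous_fun) : K := val f h.

Fact eval_at_zmod h : zmod_morphism (eval_at h).
Proof. by []. Qed.
Fact eval_at_monoid h : monoid_morphism (eval_at h).
Proof. by []. Qed.
HB.instance Definition _ h :=
  GRing.isZmodMorphism.Build continuous_fun K (eval_at h) (eval_at_zmod h).
HB.instance Definition _ h :=
  GRing.isMonoidMorphism.Build continuous_fun K (eval_at h) (eval_at_monoid h).

(** The point sends a coordinate [a] to the continuous function [a] evaluated at [F h]; ring
    operations are checked pointwise. *)
Lemma continuous_gpts_point (F : X -> X) : continuous F ->
  exists u : gpts G continuous_fun, forall h, gmap (eval_at h) u = F h.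
Proof.
move=> Fc.
have cF a : (fun h => ag_eval (F h) a) \in @continuous_pred X K.
  apply/asboolP => h.
  apply: (@continuous_comp _ _ _ F (fun h => ag_eval h a)); first exact: Fc.
  exact: gpts_eval_continuous.
pose u a : continuous_fun :=
  exist (fun f => f \in @continuous_pred X K) _ (cF a).
have uB : zmod_morphism u.
  move=> a b; apply/val_inj/funext => h /=; exact: rmorphB.
have uM : monoid_morphism u.
  split; first by apply/val_inj/funext => h /=; exact: rmorph1.
  by move=> a b; apply/val_inj/funext => h /=; exact: rmorphM.
pose uZ := GRing.isZmodMorphism.Build _ _ u uB.
pose uR := GRing.isMonoidMorphism.Build _ _ u uM.
pose U : {rmorphism ag_coord G -> continuous_fun} := HB.pack u uZ uR.
by exists U => h; exact: gpts_eq.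
Qed.

(* The product of two K-points depending continuously on h is the value at h of
   a product of points over the ring of continuous functions of h. *)
Lemma gpts_mul_continuous (F F' : X -> X) : continuous F -> continuous F' ->
  continuous (fun h => F h * F' h)%g.
Proof.
move=> /continuous_gpts_point[u uF] /continuous_gpts_point[v vF].
apply: gpts_continuous => a.
have -> : (fun h => ag_eval (F h * F' h)%g a) = val (ag_eval (u * v)%g a).
  apply/funext => h; rewrite -uF -vF.
  rewrite -[RHS]/(ag_eval (gmap (eval_at h) (u * v)%g) a).
  by congr (ag_eval _ a); exact: ag_natural.
exact/asboolP/(valP (ag_eval (u * v)%g a)).
Qed.

Lemma gpts_translation_continuous (x y : X) :
  continuous (fun h => x * h * y)%g.
Proof.
apply: gpts_mul_continuous; last exact: cst_continuous.
by apply: gpts_mul_continuous; [exact: cst_continuous|move=> h; exact: cvg_id].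
Qed.

End Translations.

(** * The Borel subgroup *)

Section BorelAlgebra.
Variables (n : nat) (D : root_datum n) (Delta : {set rd_index D}).
Variables (G : split_reductive D) (K : localFieldType).
Local Notation Ngrp := (Ngrp Delta G K).
Local Notation Bgrp := (Bgrp Delta G K).
Local Notation Tgrp := (Tgrp G K).

Lemma torus_pt_eq (R : comNzRingType) (s t : torus_pt n R) :
  (forall x, s x = t x) -> s = t.
Proof.
case: s t => [s s0 sD] [t t0 tD] /funext /= e; subst t.
by rewrite (Prop_irrelevance s0 t0) (Prop_irrelevance sD tD).
Qed.

Lemma sr_torusM (R : comNzRingType) (s t : torus_pt n R) :
  sr_torus G (torus_mul s t) = (sr_torus G s * sr_torus G t)%g.
Proof. by have [_ ->] := sr_torusP G. Qed.

Lemma sr_torus1 (R : comNzRingType) (s : torus_pt n R) :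
  (forall x, s x = 1) -> sr_torus G s = 1%g.
Proof.
move=> s1; apply: (mulgI (sr_torus G s)); rewrite mulg1 -sr_torusM.
by congr (sr_torus G _); apply: torus_pt_eq => x /=; rewrite s1 mulr1.
Qed.

Lemma Tgrp1 : Tgrp 1%g.
Proof.
exists (@TorusPt n K (fun=> 1) erefl (fun _ _ => esym (mulr1 1))) => //.
exact: sr_torus1.
Qed.

Lemma TgrpM s t : Tgrp s -> Tgrp t -> Tgrp (s * t)%g.
Proof.
by move=> [s' _ <-] [t' _ <-]; exists (torus_mul s' t') => //; exact: sr_torusM.
Qed.

Lemma Ngrp_conj g t : Ngrp g -> Tgrp t -> Ngrp (t * g * t^-1)%g.
Proof.
move=> Ng Tt; elim: Ng => [|i s neg_i|g1 g2 _ N1 _ N2|g1 _ N1].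
- by rewrite mulg1 mulgV; exact: Ngrp1.
- by have [t' _ <-] := Tt; rewrite sr_x_torus; exact: Ngrp_gen.
- rewrite (_ : _ * _ = t * g1 * t^-1 * (t * g2 * t^-1))%g; first exact: NgrpM.
  by rewrite !mulgA mulgVK.
- rewrite (_ : _ * _ = (t * g1 * t^-1)^-1)%g; first exact: NgrpV.
  by rewrite !invgM invgK mulgA.
Qed.

Lemma Ngrp_Bgrp g : Ngrp g -> Bgrp g.
Proof. by move=> Ng; exists g, 1%g; rewrite mulg1; split=> //; exact: Tgrp1. Qed.

Lemma Tgrp_Bgrp t : Tgrp t -> Bgrp t.
Proof. by move=> Tt; exists 1%g, t; rewrite mul1g; split=> //; exact: Ngrp1. Qed.

Lemma BgrpM b c : Bgrp b -> Bgrp c -> Bgrp (b * c)%g.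
Proof.
move=> [g [s [Ng Ts ->]]] [h [t [Nh Tt ->]]].
exists (g * (s * h * s^-1))%g, (s * t)%g; split.
- by apply: NgrpM => //; exact: Ngrp_conj.
- exact: TgrpM.
- by rewrite !mulgA mulgVK.
Qed.

Variables (varpi : K) (varpi0 : varpi != 0).
Local Notation tau := (torus_elt G varpi0).

Lemma torus_eltD mu nu : tau (mu + nu) = (tau mu * tau nu)%g.
Proof.
rewrite /torus_elt -sr_torusM; congr (sr_torus G _).
by apply: torus_pt_eq => x /=; rewrite ipairDr gm_powD.
Qed.

Lemma torus_eltN mu : tau (- mu) = (tau mu)^-1%g.
Proof.
apply: (mulgI (tau mu)); rewrite mulgV -torus_eltD subrr.
by apply: sr_torus1 => x /=; rewrite ipairC ipair0l.
Qed.

Lemma torus_elt_Tgrp mu : Tgrp (tau mu).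
Proof. by eexists. Qed.

(** Naturality is an axiom for products; it makes the image of 1 idempotent, hence equal to 1. *)
Lemma gpts1_natural (H : affine_group) (R S : comNzRingType)
  (f : {rmorphism R -> S}) : gmap f (1%g : gpts H R) = 1%g.
Proof.
apply: (mulgI (gmap f (1%g : gpts H R))); rewrite mulg1.
have := @ag_natural H R S f (ag_one H R) (ag_one H R); rewrite ag_mul1.
exact.
Qed.

(** The unit of G(K) is the image of the unit of G(Z), so its coordinates are images of integers,
    which are integral in [K]. *)
Lemma BO1 : BO Delta G K 1%g.
Proof.
split=> [|a]; first exact/Ngrp_Bgrp/Ngrp1.
have vge1 : vge (1 : K) 0.
  by rewrite /vge /vge_of valuation1 lexx orbT.
have vge_nat k : vge (k%:R : K) 0.
  elim: k => [|k IH]; first by rewrite /vge /vge_of eqxx.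
  by rewrite -addn1 natrD; exact: Defs.valD.
rewrite -(@gpts1_natural G int K intr) /gmap /ag_eval /=.
case: (_ a) => k; first exact: vge_nat.
by rewrite NegzE rmorphN; apply: vgeN; exact: vge_nat.
Qed.

End BorelAlgebra.

(** * Measurability of locally constant functions of a random group element *)

Section LocallyConstant.
Variables (G : affine_group) (K : localFieldType).
Context {d : measure_display} {T : measurableType d}.
Local Notation X := (gpts G K).

(** As [f] is controlled on [A] alone, the open set [U] is the interior of an implication. Local
    constancy puts every point of the event in [U], and [Y] can be treated as discrete. *)
Lemma locally_constant_measurable (Y : Type) (A : set X) (f : X -> Y)
    (Z : T -> X) (x y : X) (S : set Y) :
  locally_constant_on A f -> measurable_fun setT (Z : T -> borel_gpts G K) ->
  (forall w, A (x * Z w * y)%g) -> measurable [set w | S (f (x * Z w * y)%g)].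
Proof.
move=> fA mZ AZ; pose U : set X := [set h | A h -> S (f h)]°.
have -> : [set w | S (f (x * Z w * y)%g)] =
    setT `&` Z @^-1` ((fun h => x * h * y)%g @^-1` U).
  apply/seteqP; split=> [w Sw|w [_ /interior_subset SZ]]; last exact: SZ (AZ w).
  have fZ : \forall h \near (x * Z w * y)%g, A h -> f h = f (x * Z w * y)%g.
    exact: fA.
  split=> //; apply: filterS fZ => h fh Ah.
  by have -> : f h = f (x * Z w * y)%g by exact: fh.
apply: mZ => //; apply: sub_sigma_algebra.
apply: open_comp; last exact: open_interior.
by move=> h _; exact: gpts_translation_continuous.
Qed.

End LocallyConstant.

(** * The Poisson formula *)

(** An interior point can be moved by a small [e > 0] against the coordinate vector [v] of the
    coroot. This lowers the pairing by [e * rpair v v > 0], where [v] is non-zero because root and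
    coroot pair to 2. *)
Lemma weyl_chamber_interior_gt0 (R : realType) n (D : root_datum n)
    (Delta : {set rd_index D}) (z : 'rV[R]_n) a :
  ((weyl_chamber R Delta)°) z -> a \in Delta ->
  0 < rpair z (real_vect R (coroot_of a)).
Proof.
move=> z_int aD; set v := real_vect R _.
have v_gt0 : 0 < rpair v v.
  rewrite lt_neqAle sumr_ge0 ?andbT => [|k _]; last by rewrite -expr2 sqr_ge0.
  apply/eqP => /esym/eqP.
  rewrite psumr_eq0 => [/allP v0|k _]; last by rewrite -expr2 sqr_ge0.
  have : ipair (root_of a) (coroot_of a) = 0.
    apply: big1 => k _; have := v0 k (mem_index_enum k).
    by rewrite /= mulf_eq0 orbb mxE intr_eq0 => /eqP ->; rewrite mulr0.
  by rewrite root_coroot2.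
have : \forall e \near (0 : R)^'+, weyl_chamber R Delta (z - e *: v).
  have : z - e *: v @[e --> (0 : R)^'+] --> z.
    apply: cvg_at_right_filter.
    rewrite -[X in _ --> X](subr0 z) -[X in _ - X](scale0r v).
    by apply: cvgB; [exact: cvg_cst|apply: cvgZr_tmp; exact: cvg_id].
  by move=> /(_ _ z_int).
move=> near_e.
have [e [e0 /(_ a aD)]] : exists e : R, 0 < e /\ weyl_chamber R Delta (z - e *: v).
  near (0 : R)^'+ => e; exists e; split; last by near: e.
  by near: e; exact: nbhs_right_gt.
have -> : rpair (z - e *: v) (real_vect R (coroot_of a)) =
    rpair z v - e * rpair v v.
  rewrite /rpair mulr_sumr -sumrB; apply: eq_bigr => k _.
  by rewrite 3!mxE -/v; ring.
by rewrite subr_ge0; apply: lt_le_trans; rewrite mulr_gt0.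
Unshelve. all: by end_near. Qed.

(** * Bounded convergence for real and imaginary parts *)

Section BoundedConvergence.
Context {d : measure_display} {T : measurableType d} {R : realType}.
Variable P : probability T R.

Lemma measurable_fun_preimage (d' : measure_display) (U : measurableType d')
    (f : T -> U) :
  (forall S : set U, measurable (f @^-1` S)) -> measurable_fun setT f.
Proof. by move=> mf _ A _; rewrite setTI. Qed.

Lemma bounded_measurable_integrable (f : T -> R) (M : R) :
  measurable_fun setT f -> (forall w, `|f w| <= M) ->
  P.-integrable setT (EFin \o f).
Proof.
move=> mf fM; apply: measurable_bounded_integrable => //.
  by rewrite (le_lt_trans (probability_le1 P measurableT))// ltry.
exists M; split; first exact: num_real.
by move=> x /ltW Mx w _; exact: le_trans (fM w) Mx.
Qed.

Lemma Rintegral_bounded_convergence (f : nat -> T -> R) (g : T -> R) (M c : R) :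
  (forall t, measurable_fun setT (f t)) -> measurable_fun setT g ->
  (forall t w, `|f t w| <= M) -> {ae P, forall w, f ^~ w @ \oo --> g w} ->
  (forall t, Rintegral P setT (f t) = c) -> Rintegral P setT g = c.
Proof.
move=> mf mg fM fg fc.
have [|||||ig _ cvg_int] := @dominated_convergence _ _ _ P setT measurableT
    (fun t w => (f t w)%:E) (fun w => (g w)%:E) (cst M%:E).
- by move=> t; exact/measurable_EFinP.
- exact/measurable_EFinP.
- by apply: filterS fg => w fgw _; apply: cvg_EFin => //; exact: nearW.
- exact: finite_measure_integrable_cst.
- by apply: aeW => w t _; rewrite /= lee_fin.
rewrite /Rintegral -(cvg_lim (@ereal_hausdorff R) cvg_int).
rewrite (_ : [sequence _]_n = cst c%:E) ?lim_cst//; apply/funext => t /=.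
rewrite -(fc t) /Rintegral fineK//; apply: integrable_fin_num => //.
exact: bounded_measurable_integrable (fM t).
Qed.

End BoundedConvergence.

Section ComplexParts.
Context {d : measure_display} {T : measurableType d} {R : realType}.
Variable P : probability T R.
Variable part : R[i] -> R.
Hypothesis partB : {morph part : x y / x - y}.
Hypothesis partZ : forall (r : R) x, part (r%:C%C * x) = r * part x.
Hypothesis part_le : forall x, (`|part x|)%:C%C <= `|x|.

(** [part] stands for the real or the imaginary part. Measurability of [Phi] is asked when [L != 0],
    the case in which it will be derived; when [L = 0] the limit is the zero function. *)
Lemma part_bounded_convergence (F : nat -> T -> R[i]) (Phi : T -> R[i])
    (L M c : R) :
  (forall t, measurable_fun setT (part \o F t)) ->
  (L != 0 -> measurable_fun setT (part \o Phi)) ->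
  (forall t w, `|F t w| <= M%:C%C) -> (forall w, `|Phi w| = 1) ->
  {ae P, forall w, forall e : R, 0 < e ->
    \forall t \near \oo, `|F t w - L%:C%C * Phi w| < e%:C%C} ->
  (forall t, Rintegral P setT (part \o F t) = c) ->
  c = L * Rintegral P setT (part \o Phi).
Proof.
move=> mF mPhi FM Phi1 cvgF Fc.
have <- : Rintegral P setT (fun w => L * part (Phi w)) = c.
  apply: (@Rintegral_bounded_convergence _ _ _ P (fun t => part \o F t) _ M) => //.
  - have [L0|/mPhi mp] := eqVneq L 0; last by apply: measurable_funM.
    rewrite (_ : (fun _ => _) = cst 0)//; apply/funext => w.
    by rewrite L0 mul0r.
  - by move=> t w; rewrite -lecR; exact: le_trans (part_le _) (FM t w).
  - apply: filterS cvgF => w Fw; apply/cvgrPdist_lt => e e0.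
    apply: filterS (Fw e e0) => t Ft.
    rewrite distrC -ltcR -partZ -partB; exact: le_lt_trans (part_le _) Ft.
have [->|L0] := eqVneq L 0.
  rewrite mul0r (_ : (fun _ => _) = cst 0) ?Rintegral_cst ?mul0r//.
  by apply/funext => w; rewrite mul0r.
rewrite RintegralZl//; apply: (@bounded_measurable_integrable _ _ _ P _ 1).
  exact: mPhi.
by move=> w; rewrite -lecR (le_trans (part_le _))// Phi1.
Qed.

End ComplexParts.

Lemma normc_ge_Im (R : rcfType) (x : R[i]) : (`|complex.Im x|)%:C%C <= `|x|.
Proof.
by rewrite normc_def lecR -sqrtr_sqr ler_wsqrtr// lerDr sqr_ge0.
Qed.

Section EquivariantFunction.
Variables (R : realType) (n : nat) (D : root_datum n) (Delta : {set rd_index D}).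
Variables (G : split_reductive D) (K : localFieldType).
Variables (phi f : gpts G K -> R[i]).
Hypothesis f_equiv : forall g x, Ngrp Delta G K g -> Bgrp Delta G K x ->
  f (g * x)%g = phi g * f x.

Lemma equivariant_locally_constant y :
  locally_constant_on (Bgrp Delta G K) f -> Bgrp Delta G K y -> f y != 0 ->
  locally_constant_on (Ngrp Delta G K) phi.
Proof.
move=> f_lc By fy0 g Ng.
have Bgy h : Ngrp Delta G K h -> Bgrp Delta G K (h * y)%g.
  by move=> Nh; apply: BgrpM => //; exact: Ngrp_Bgrp.
(* The factor 1 gives the shape [x * h * y] of a two-sided translation. *)
have f_near : \forall h \near (1 * g * y)%g,
    Bgrp Delta G K h -> f h = f (g * y)%g.
  by rewrite mul1g; exact: f_lc (Bgy g Ng).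
have near_g : \forall h \near g,
    Bgrp Delta G K (1 * h * y)%g -> f (1 * h * y)%g = f (g * y)%g.
  exact: gpts_translation_continuous f_near.
apply: filterS near_g => h /= fh Nh; apply: (mulIf fy0).
by rewrite -!f_equiv//; rewrite mul1g in fh; apply: fh; exact: Bgy.
Qed.

End EquivariantFunction.

Theorem proposition3p4
    (R : realType) (K : localFieldType)
    (varpi : K) (varpi0 : varpi != 0) (val_varpi : valuation varpi = 1)
    (n : nat) (D : root_datum n) (G : split_reductive D)
    (Delta : {set rd_index D}) (Delta_base : is_base Delta)
    (Gv : split_reductive (dual_datum D))
    (Lambda : 'rV[int]_n) (Lambda_minuscule : minuscule R Delta Lambda)
    (V : rational_rep Gv R[i])
    (V_Lambda : is_highest_weight_module
                  (Delta : {set rd_index (dual_datum D)}) V Lambda)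
    (psi : K -> R[i]) (psiP : additive_character psi)
    (chim : rd_index D -> gpts G K -> K)
    (chimP : forall a, a \in Delta ->
       simple_additive_character Delta a (chim a))
    (phiN : gpts G K -> R[i])
    (phiNE : forall g, Ngrp Delta G K g ->
       phiN g = psi (\sum_(a in Delta) chim a g))
    (z : 'rV[R]_n) (z_int : ((weyl_chamber R Delta)°) z)
    (chi : gpts G K -> R[i])
    (chiP : unramified_character Delta varpi0 z chi)
    (d : measure_display) (T : measurableType d) (P : probability T R)
    (W : nat -> T -> 'rV[int]_n)
    (W_walk : weight_walk P D Lambda z (rep_char V z) W)
    (b b' B : nat -> T -> gpts G K)
    (B_walk : group_walk P Delta varpi0 W b b' B)
    (N : nat -> T -> gpts G K) (N_partB : N_part Delta varpi0 W B N)
    (Ninf : T -> gpts G K) (Ninf_lim : almost_sure_limit P Delta N Ninf)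
    (psichi : gpts G K -> R[i])
    (psichi_lc : locally_constant_on (Bgrp Delta G K) psichi)
    (psichi_harmonic : forall t x, Bgrp Delta G K x ->
       cexpect P (fun w => (chi (x * B t w)%g)^-1 * psichi (x * B t w)%g)
       = (chi x)^-1 * psichi x)
    (psichi_bounded : exists M : R, forall x, Bgrp Delta G K x ->
       `|(chi x)^-1 * psichi x| <= M%:C%C)
    (psichi_limit : forall eps : R, 0 < eps -> exists M : int,
       forall lam : 'rV[int]_n,
         (forall a, a \in Delta -> M <= ipair (root_of a) lam) ->
         `|(chi (torus_elt G varpi0 (- lam)))^-1 *
             psichi (torus_elt G varpi0 (- lam))
           - (bconst Delta z * expR (rpair z (rho_vee R Delta)))%:C%C|
         < eps%:C%C)
    (psichi_equivariant : forall g x k,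
       Ngrp Delta G K g -> Bgrp Delta G K x -> BO Delta G K k ->
       psichi (g * x * k)%g = phiN g * psichi x)
    (lam : 'rV[int]_n) :
  psichi (torus_elt G varpi0 (- lam)) =
    (bconst Delta z *
       expR (rpair z (real_vect R lam + rho_vee R Delta)))%:C%C *
    cexpect P (fun w =>
      phiN (torus_elt G varpi0 (- lam) * Ninf w * torus_elt G varpi0 lam)%g).

Proof.
have [mW W0 _ _] := W_walk.
have [chiM chiN chiTO chi_tau] := chiP.
have [_ _ _ mB [_ _]] := B_walk.
have [mNinf Ninf_N Ninf_cvg] := Ninf_lim.
have [psiM psi1 _ _ _] := psiP.
set tau := torus_elt G varpi0.
have tauB mu : Bgrp Delta G K (tau mu) by apply: Tgrp_Bgrp; exact: torus_elt_Tgrp.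
pose x := tau (- lam).
have xinv : tau lam = (x^-1)%g by rewrite /x /tau torus_eltN invgK.
have xT : Tgrp G K x by exact: torus_elt_Tgrp.
pose rz mu : R := rpair z (real_vect R mu).
set L := bconst Delta z * expR (rpair z (rho_vee R Delta)).
pose g mu := (chi (tau (- mu)))^-1 * psichi (tau (- mu)).
pose Phi w := phiN (x * Ninf w * tau lam)%g.
pose F t w := (chi (x * B t w)%g)^-1 * psichi (x * B t w)%g.
have equiv h y : Ngrp Delta G K h -> Bgrp Delta G K y ->
    psichi (h * y)%g = phiN h * psichi y.
  by move=> Nh By; rewrite -[(h * y)%g]mulg1 psichi_equivariant//; exact: BO1.
have phi_norm h : Ngrp Delta G K h -> `|phiN h| = 1.
  by move=> Nh; rewrite phiNE.
have conjN h : Ngrp Delta G K h -> Ngrp Delta G K (x * h * tau lam)%g.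
  by move=> Nh; rewrite xinv; exact: Ngrp_conj.
(* Conjugating [N t w] by [x] brings [x * B t w] to the form N, torus, T(O), from which [chi] and
   [psichi] are read off. *)
have xBE t w : exists2 c, TO G K c &
    (x * B t w = x * N t w * tau lam * tau (- (lam + W t w)) * c)%g.
  have [_ [c Tc ->]] := N_partB t w; exists c => //.
  rewrite opprD /tau torus_eltD -/tau !mulgA xinv; congr (_ * _ * _)%g.
  by rewrite mulgVK.
have TO_BO c : TO G K c -> BO Delta G K c.
  by move=> [Tc Kc]; split=> //; exact: Tgrp_Bgrp.
have chi_xB t w : chi (x * B t w)%g = (expR (rz (lam + W t w)))%:C%C.
  have [NN _] := N_partB t w; have [c Tc ->] := xBE t w.
  have [Bc _] := TO_BO _ Tc.
  have NxN := conjN _ NN; have BxN := Ngrp_Bgrp NxN.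
  have BxNt := BgrpM BxN (tauB (- (lam + W t w))).
  rewrite (chiM _ _ BxNt Bc) (chiM _ _ BxN (tauB _)).
  by rewrite (chiN _ NxN) (chiTO _ Tc) mul1r mulr1 chi_tau.
have psi_xB t w : psichi (x * B t w)%g =
    phiN (x * N t w * tau lam)%g * psichi (tau (- (lam + W t w))).
  have [NN _] := N_partB t w; have [c Tc ->] := xBE t w.
  by rewrite psichi_equivariant//; [exact: conjN|exact: TO_BO].
have FE t w : F t w = phiN (x * N t w * tau lam)%g * g (lam + W t w).
  by rewrite /F chi_xB psi_xB /g chi_tau mulrCA.
(* The trailing 1 matches the two-sided translation in [locally_constant_measurable]. *)
have Bx t w : Bgrp Delta G K (x * B t w * 1)%g.
  have [NN _] := N_partB t w; have [c Tc ->] := xBE t w.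
  have [Bc _] := TO_BO _ Tc; rewrite mulg1; apply: BgrpM => //; apply: BgrpM => //.
  exact/Ngrp_Bgrp/conjN.
have escape : {ae P, forall w, forall M : int, \forall t \near \oo,
    forall a, a \in Delta -> M <= ipair (root_of a) (lam + W t w)}.
  have : {ae P, forall w a, a \in Delta -> forall M : int,
      \forall t \near \oo, M <= ipair (root_of a) (W t w)}.
    apply: filter_forall => a; have [aD|aD] := boolP (a \in Delta); last exact: aeW.
    have := weight_walk_escape W_walk (weyl_chamber_interior_gt0 z_int aD)
      (minuscule_orbit_pairing a Lambda_minuscule).
    by apply: filterS.
  apply: filterS => w esc M; apply: filter_forall => a.
  have [aD|aD] := boolP (a \in Delta); last exact: nearW.
  apply: filterS (esc a aD (M - ipair (root_of a) lam)) => t Mt _.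
  by rewrite ipairDr -lerBlDl.
have g_cvg : {ae P, forall w, forall e : R, 0 < e ->
    \forall t \near \oo, `|g (lam + W t w) - L%:C%C| < e%:C%C}.
  apply: filterS escape => w esc e e0.
  have [M ML] := psichi_limit e e0.
  by apply: filterS (esc M) => t Mt; exact: ML.
(* An almost sure event is non-empty. At a sample point where [g (lam + W t w)] tends to [L], some
   value is within [|L|] of [L], hence non-zero, and yields the point where [psichi] does not
   vanish. *)
have phi_lc : L != 0 -> locally_constant_on (Ngrp Delta G K) phiN.
  move=> L0.
  have P0 : (0 < P setT)%E by rewrite probability_setT lte01.
  have [w gw] := @filter_ex _ _ (ae_properfilter_algebraOfSetsType P0) _ g_cvg.
  have := gw `|L|; rewrite normr_gt0 => /(_ L0) near_t.
  have [t gt] := @filter_ex _ _ eventually_filter _ near_t.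
  apply: (equivariant_locally_constant equiv psichi_lc (tauB (- (lam + W t w)))).
  apply: contraTneq gt => psi0.
  by rewrite /g psi0 mulr0 sub0r normrN normc_def /= expr0n addr0 sqrtr_sqr ltxx.
have FM : exists M : R, forall t w, `|F t w| <= M%:C%C.
  have [M psiM'] := psichi_bounded; exists M => t w; apply: psiM'.
  by rewrite -[(x * B t w)%g]mulg1; exact: Bx.
have F_cvg : {ae P, forall w, forall e : R, 0 < e ->
    \forall t \near \oo, `|F t w - L%:C%C * Phi w| < e%:C%C}.
  apply: filterS2 g_cvg Ninf_cvg => w gw Nw e e0.
  (* For [L != 0] the values of [phiN] along the converging sequence are eventually equal to the
     limit value, by local constancy. *)
  have LPhi : \forall t \near \oo,
      L%:C%C * phiN (x * N t w * tau lam)%g = L%:C%C * Phi w.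
    have [->|/phi_lc lc] := eqVneq L 0; first by apply: nearW => t; rewrite !mul0r.
    have conj_cvg := cvg_comp _ _ Nw
      (@gpts_translation_continuous G K x (tau lam) (Ninf w)).
    have lcw : \forall h \near (x * Ninf w * tau lam)%g,
        Ngrp Delta G K h -> phiN h = Phi w by apply: lc; exact: conjN.
    have lct : \forall t \near \oo, Ngrp Delta G K (x * N t w * tau lam)%g ->
        phiN (x * N t w * tau lam)%g = Phi w by exact: conj_cvg lcw.
    apply: filterS lct => t -> //.
    by apply: conjN; have [] := N_partB t w.
  apply: filterS2 LPhi (gw e e0) => t LPhit gt.
  (* The common factor [phiN] has modulus 1, so the distance is that of [g (lam + W t w)] to [L]. *)
  rewrite -LPhit FE mulrC -mulrBl normrM phi_norm ?mulr1//.
  by apply: conjN; have [] := N_partB t w.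
have [M F_bounded] := FM.
have Phi1 w : `|Phi w| = 1 by apply: phi_norm; exact: conjN.
have intF t : cexpect P (F t) = (chi x)^-1 * psichi x.
  by apply: psichi_harmonic; exact: tauB.
have parts (part : R[i] -> R) : {morph part : u v / u - v} ->
    (forall (r : R) u, part (r%:C%C * u) = r * part u) ->
    (forall u, (`|part u|)%:C%C <= `|u|) ->
    (forall t, Rintegral P setT (part \o F t) = part ((chi x)^-1 * psichi x)) ->
    part ((chi x)^-1 * psichi x) = L * Rintegral P setT (part \o Phi).
  move=> partB partZ part_le intpart.
  apply: (part_bounded_convergence partB partZ part_le _ _ F_bounded Phi1 F_cvg).
  - move=> t.
    (* [chi] is real on [x * B t w] and can be pulled out of [part]. The two factors are a function
       of the countably valued walk and a locally constant function of [B t]. *)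
    have -> : part \o F t = (fun w => (expR (rz (lam + W t w)))^-1) \*
        (fun w => part (psichi (x * B t w * 1)%g)).
      by apply/funext => w /=; rewrite mulg1 -partZ /F chi_xB fmorphV.
    apply: measurable_funM; apply: measurable_fun_preimage => S.
      exact: (measurable_countable_preimage (mW t)
        [set mu | S (expR (rz (lam + mu)))^-1]).
    exact: (locally_constant_measurable [set u | S (part u)] psichi_lc
      (mB t) (Bx t)).
  - move=> /phi_lc lc; apply: measurable_fun_preimage => S.
    apply: (locally_constant_measurable [set u | S (part u)] lc mNinf) => w.
    exact: conjN.
  - exact: intpart.
have vE : (chi x)^-1 * psichi x = L%:C%C * cexpect P Phi.
  apply/eqP; rewrite eq_complex; apply/andP; split; apply/eqP.
  - rewrite (parts (@complex.Re R)).
    + by rewrite /= mul0r subr0.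
    + by case=> ? ? [].
    + by move=> r [? ?] /=; rewrite mul0r subr0.
    + exact: normc_ge_Re.
    + by move=> t; rewrite -(intF t).
  - rewrite (parts (@complex.Im R)).
    + by rewrite /= mul0r addr0.
    + by case=> ? ? [].
    + by move=> r [? ?] /=; rewrite mul0r addr0.
    + exact: normc_ge_Im.
    + by move=> t; rewrite -(intF t).
have chix0 : chi x != 0.
  by rewrite chi_tau (inj_eq (@complexI R) _ 0) gt_eqF ?expR_gt0.
(* Multiplying back by [chi x], the exponential of [<z, lam>], merges it with the exponential of
   [<z, rho^vee>] in [L]. *)
rewrite -[LHS](mulVKf chix0) -/x vE mulrA chi_tau -rmorphM; congr (_%:C%C * _).
rewrite /L mulrCA -expRD; congr (_ * expR _).
by rewrite /rpair -big_split; apply: eq_bigr => k _; rewrite /= [in RHS]mxE mulrDr.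
Qed.
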